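(* Consider the problem $\min_{x\in\mathbb{R}^{d_x}}\max_{y\in\mathbb{R}^{d_y}}\{f(x)+G(x,y)-h(y)\}$, where $f$ is $L_f$-smooth and $\mu_x$-strongly convex; $G$ is convex in $x$, concave in $y$ and $L_G$-smooth jointly in $(x,y)$; $h$ is $L_h$-smooth and $\mu_y$-strongly convex. Assume additionally $\mu_x\le L_G$, $\mu_x\le L_f$ and $\mu_y\le L_G$. Then for any $\varepsilon>0$ there is a (deterministic first-order) algorithm that finds an $\varepsilon$-solution to this problem with the following numbers of basic oracle calls: $$\nabla f:\ \widetilde O\left(\sqrt{\frac{L_GL_f}{\mu_x\mu_y}}\right),\qquad\nabla h:\ \widetilde O\left(\max\left\{\sqrt{\frac{L_GL_h}{\mu_x\mu_y}},\sqrt{\frac{L_G^2}{\mu_x\mu_y}}\right\}\right),$$ $$\nabla_xG:\ \widetilde O\left(\sqrt{\frac{L_G^2}{\mu_x\mu_y}}\right),\qquad\nabla_yG:\ \widetilde O\left(\sqrt{\frac{L_G^2}{\mu_x\mu_y}}\right).$$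
   Context: Norms are Euclidean. A function is $L$-smooth if its gradient is $L$-Lipschitz; for $G$: $\|\nabla G(x_1,x_2)-\nabla G(y_1,y_2)\|\le L_G\|(x_1,x_2)-(y_1,y_2)\|$ on $\mathbb{R}^{d_x}\times\mathbb{R}^{d_y}$. A basic oracle call is one evaluation of $\nabla f(x)$, of $\nabla h(y)$, of $\nabla_xG(x,y)$, or of $\nabla_yG(x,y)$, respectively. $\widetilde O(X)$ hides constant factors and factors polylogarithmic in $\varepsilon^{-1}$. A point $\hat y$ is an $\varepsilon$-solution of the saddle-point problem if $h(\hat y)+\max_{x}\{-G(x,\hat y)-f(x)\}-\min_{y}\max_{x}\{h(y)-G(x,y)-f(x)\}\le\varepsilon$. *)

(* Defs.v *)
From HB Require Import structures.
From mathcomp Require Import all_boot all_order all_algebra.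
From mathcomp Require Import all_classical all_reals all_analysis.

Set Implicit Arguments.
Unset Strict Implicit.
Unset Printing Implicit Defensive.

Import Order.TTheory GRing.Theory Num.Theory.
Import numFieldNormedType.Exports.

Local Open Scope classical_set_scope.
Local Open Scope ring_scope.

(* The library norm on 'rV[R]_n is the sup norm.  Differentiability does not   *)
(* depend on the choice of norm, but Lipschitz and strong convexity constants  *)
(* do, hence the explicit Euclidean norm.                                      *)
Definition enorm (R : realType) (n : nat) (x : 'rV[R]_n) : R :=
  Num.sqrt (\sum_(i < n) x 0 i ^+ 2).

(* Only meaningful where f is differentiable, which L_smooth below requires.   *)
Definition grad (R : realType) (n : nat) (f : 'rV[R]_n -> R) (x : 'rV[R]_n) :
    'rV[R]_n :=
  \row_(i < n) 'D_(delta_mx 0 i) f x.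

Definition L_smooth (R : realType) (n : nat) (L : R) (f : 'rV[R]_n -> R) : Prop :=
  (forall x, differentiable f x) /\
  (forall x y, enorm (grad f x - grad f y) <= L * enorm (x - y)).

(* R^dx x R^dy, with its product Euclidean norm, is identified with R^(dx+dy). *)
Definition uncurry_row (R : realType) (dx dy : nat)
    (G : 'rV[R]_dx -> 'rV[R]_dy -> R) (z : 'rV[R]_(dx + dy)) : R :=
  G (lsubmx z) (rsubmx z).

Definition grad_x (R : realType) (dx dy : nat)
    (G : 'rV[R]_dx -> 'rV[R]_dy -> R) x y : 'rV[R]_dx :=
  grad (fun x' => G x' y) x.

Definition grad_y (R : realType) (dx dy : nat)
    (G : 'rV[R]_dx -> 'rV[R]_dy -> R) x y : 'rV[R]_dy :=
  grad (G x) y.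

Definition convex_fun (R : realType) (n : nat) (f : 'rV[R]_n -> R) : Prop :=
  @convex_function R 'rV[R]_n setT f.

Definition strongly_convex (R : realType) (n : nat) (mu : R)
    (f : 'rV[R]_n -> R) : Prop :=
  forall (x y : 'rV[R]_n) (t : R), 0 <= t <= 1 ->
    f (t *: x + (1 - t) *: y) <=
      t * f x + (1 - t) * f y - mu / 2 * t * (1 - t) * enorm (x - y) ^+ 2.

Definition is_max (R : realType) (T : Type) (u : T -> R) (m : R) : Prop :=
  (exists a, u a = m) /\ (forall a, u a <= m).

Definition is_min (R : realType) (T : Type) (u : T -> R) (m : R) : Prop :=
  (exists a, u a = m) /\ (forall a, m <= u a).

(* M = max_x {- G(x, yhat) - f(x)}, phi y = max_x {h(y) - G(x, y) - f(x)} and  *)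
(* v = min_y phi y; all these extrema are asserted to be attained.             *)
Definition eps_solution (R : realType) (dx dy : nat) (f : 'rV[R]_dx -> R)
    (G : 'rV[R]_dx -> 'rV[R]_dy -> R) (h : 'rV[R]_dy -> R)
    (eps : R) (yhat : 'rV[R]_dy) : Prop :=
  exists (M : R) (phi : 'rV[R]_dy -> R) (v : R),
    [/\ is_max (fun x => - G x yhat - f x) M,
        forall y, is_max (fun x => h y - G x y - f x) (phi y),
        is_min phi v &
        h yhat + M - v <= eps].

Definition saddle_point (R : realType) (dx dy : nat) (f : 'rV[R]_dx -> R)
    (G : 'rV[R]_dx -> 'rV[R]_dy -> R) (h : 'rV[R]_dy -> R)
    (xs : 'rV[R]_dx) (ys : 'rV[R]_dy) : Prop :=
  forall x y,
    f xs + G xs y - h y <= f xs + G xs ys - h ys <= f x + G x ys - h ys.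

(* A deterministic first-order algorithm is a decision tree: it either stops   *)
(* with an output or asks one oracle query, and its continuation is a function *)
(* of the answer.  The tree is inductive, so every run terminates, and f, G, h *)
(* are accessible only through the answers.                                    *)
Inductive algorithm (X Y : Type) : Type :=
| Output of Y
| Query_f of X & (X -> algorithm X Y)
| Query_h of Y & (Y -> algorithm X Y)
| Query_Gx of X & Y & (X -> algorithm X Y)
| Query_Gy of X & Y & (Y -> algorithm X Y).

Record outcome (Y : Type) := Outcome {
  out : Y;
  calls_f : nat;
  calls_h : nat;
  calls_Gx : nat;
  calls_Gy : nat
}.

Fixpoint run_oracles (X Y : Type) (of_ : X -> X) (oh : Y -> Y)
    (ox : X -> Y -> X) (oy : X -> Y -> Y) (A : algorithm X Y) : outcome Y :=
  match A with
  | Output y => Outcome y 0 0 0 0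
  | Query_f x k =>
      let: Outcome y a b c d := run_oracles of_ oh ox oy (k (of_ x)) in
      Outcome y a.+1 b c d
  | Query_h y' k =>
      let: Outcome y a b c d := run_oracles of_ oh ox oy (k (oh y')) in
      Outcome y a b.+1 c d
  | Query_Gx x y' k =>
      let: Outcome y a b c d := run_oracles of_ oh ox oy (k (ox x y')) in
      Outcome y a b c.+1 d
  | Query_Gy x y' k =>
      let: Outcome y a b c d := run_oracles of_ oh ox oy (k (oy x y')) in
      Outcome y a b c d.+1
  end.

Definition run (R : realType) (dx dy : nat) (f : 'rV[R]_dx -> R)
    (G : 'rV[R]_dx -> 'rV[R]_dy -> R) (h : 'rV[R]_dy -> R)
    (A : algorithm 'rV[R]_dx 'rV[R]_dy) : outcome 'rV[R]_dy :=
  run_oracles (grad f) (grad h) (grad_x G) (grad_y G) A.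

(* The soft-O bound of X: C and k are absolute constants, and the hidden       *)
(* factor is polylogarithmic in 1/eps and in the size S of the problem data.   *)
Definition soft_O (R : realType) (C k : nat) (S eps X : R) : R :=
  C%:R * (1 + ln (1 + S)) ^+ k * (1 + ln (1 + eps^-1)) ^+ k * X.

(* Size of the data: smoothness and strong convexity parameters, and distance  *)
(* D from the starting point to the saddle point.                              *)
Definition data_size (R : realType) (L_f L_G L_h mu_x mu_y D : R) : R :=
  L_f + L_G + L_h + mu_x^-1 + mu_y^-1 + D.

(* Main.v *)
Require Import Defs.
From HB Require Import structures.
From mathcomp Require Import all_boot all_order all_algebra.
From mathcomp Require Import all_classical all_reals all_analysis.
From mathcomp Require Import ring lra zify.

Set Implicit Arguments.
Unset Strict Implicit.
Unset Printing Implicit Defensive.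

Import Order.TTheory GRing.Theory Num.Theory.
Import numFieldNormedType.Exports.

Local Open Scope ring_scope.

(* With G well conditioned in both variables, one forward step on G followed  *)
(* by separate proximal steps on f and h contracts the distance to the saddle *)
(* point.  Conditioning is bought by inexact accelerated proximal point       *)
(* loops, first in y (regularization L_G), then in x (regularization          *)
(* min(L_f, L_G)); if L_f < L_G, a forward step on f is inserted before a     *)
(* second loop in x, so that f is called less often than G.  Every inner      *)
(* solver only has to divide the distance to the solution of its subproblem   *)
(* by a factor polynomial in the data; the Lyapunov function of the           *)
(* accelerated loop absorbs this relative error, including the error on the   *)
(* non-accelerated block, so no absolute accuracy is tracked.                 *)

(** * Euclidean inner product *)

(** The saddle point is the zero of the operator ([opX], [opY]), strongly monotone with moduli mu_x
    and mu_y; it exists by a contraction argument ([strongly_monotone_root], [op_root]).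

    Two transformations of solvers carry the complexity. [solvable_forward] moves an L-Lipschitz
    summand out of the operator: when the regularization is at least L in both blocks, a forward
    step on this summand, followed by solving the rest with 3 L more regularization, contracts
    distances by a constant. [solvable_catX] and [solvable_catY] are accelerated proximal loops:
    they grant regularization lam to a block of modulus mu for a factor sqrt(lam / mu), up to
    logarithms. The error on the other block is controlled because the best response is Lipschitz
    ([sensitivityX], [sensitivityY]).

    The factors telescope. Regularizing y by L_G costs sqrt(L_G / mu_y). If L_G <= L_f
    ([solvable_saddle_sharp_f]), regularizing x costs sqrt(L_G / mu_x); G is called once per forward
    step, and the separate proximal steps cost sqrt(L_f / L_G) calls for f and sqrt(max(L_h, L_G) /
    L_G) for h. If L_f <= L_G ([solvable_saddle_flat_f]), x is regularized in two stages: by L_f,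
    costing sqrt(L_f / mu_x), after which f is called, then by L_G, costing a further sqrt(L_G /
    L_f) that f does not pay.

    The resulting solver halves the squared distance to the saddle point. It is repeated
    logarithmically often, a number computed from the gradient at the starting point ([root_dist]),
    until the primal gap, which is at most a multiple of the squared distance, is small
    ([root_eps_solution]). *)

Section InnerProduct.
Variables (R : realFieldType) (n : nat).
Implicit Types (x y z : 'rV[R]_n) (c : R).

Definition dot x y : R := \sum_(i < n) x 0 i * y 0 i.
Definition sqn x : R := dot x x.

Lemma dotC x y : dot x y = dot y x.
Proof. by apply: eq_bigr => i _; rewrite mulrC. Qed.

Lemma dotDl x y z : dot (x + y) z = dot x z + dot y z.
Proof. by rewrite -big_split; apply: eq_bigr => i _; rewrite mxE mulrDl. Qed.

Lemma dotZl c x y : dot (c *: x) y = c * dot x y.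
Proof. by rewrite mulr_sumr; apply: eq_bigr => i _; rewrite mxE mulrA. Qed.

Lemma dotNl x y : dot (- x) y = - dot x y.
Proof. by rewrite -scaleN1r dotZl mulN1r. Qed.

Lemma dotDr x y z : dot z (x + y) = dot z x + dot z y.
Proof. by rewrite !(dotC z) dotDl. Qed.

Lemma dotZr c x y : dot y (c *: x) = c * dot y x.
Proof. by rewrite !(dotC y) dotZl. Qed.

Lemma dotNr x y : dot y (- x) = - dot y x.
Proof. by rewrite !(dotC y) dotNl. Qed.

Lemma dot0l x : dot 0 x = 0.
Proof. by rewrite -(scale0r x) dotZl mul0r. Qed.

Lemma dot0r x : dot x 0 = 0.
Proof. by rewrite dotC dot0l. Qed.

Lemma sqn_ge0 x : 0 <= sqn x.
Proof. by apply: sumr_ge0 => i _; rewrite -expr2 sqr_ge0. Qed.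

Lemma sqn0 : sqn 0 = 0.
Proof. exact: dot0l. Qed.

Lemma sqnN x : sqn (- x) = sqn x.
Proof. by rewrite /sqn dotNl dotNr opprK. Qed.

Lemma sqnBC x y : sqn (x - y) = sqn (y - x).
Proof. by rewrite -sqnN opprB. Qed.

End InnerProduct.

Definition dotE := (dotDl, dotDr, dotNl, dotNr, dotZl, dotZr, dot0l, dot0r).

Ltac dot_expand :=
  rewrite /sqn ?dotE;
  repeat match goal with |- context [dot ?a ?b] =>
    match goal with |- context [dot b a] =>
      tryif constr_eq a b then fail else rewrite (dotC b a) end end.

Section InnerProductInequalities.
Variables (R : realFieldType) (n : nat).
Implicit Types (x y z : 'rV[R]_n) (c : R).

Lemma sqnZ c x : sqn (c *: x) = c ^+ 2 * sqn x.
Proof. by dot_expand; ring. Qed.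

(** Young's inequality: the two sides differ by c^-1 |c x - y|^2. *)
Lemma sqnD_le c x y : 0 < c ->
  sqn (x + y) <= (1 + c) * sqn x + (1 + c^-1) * sqn y.
Proof.
move=> c0; have := sqn_ge0 (c *: x - y); dot_expand => h.
have -> : (1 + c) * dot x x + (1 + c^-1) * dot y y =
   dot x x + dot x y + (dot x y + dot y y) + c^-1 *
   (c * (c * dot x x) + - (c * dot x y) + (- (c * dot x y) - - dot y y)).
  by field; rewrite gt_eqF.
by rewrite lerDl; apply: mulr_ge0; [rewrite invr_ge0 ltW|lra].
Qed.

Lemma sqn_triangle x y z : sqn (x - z) <= 2 * sqn (x - y) + 2 * sqn (y - z).
Proof. by have := sqn_ge0 (x - y - (y - z)); dot_expand => h; lra. Qed.

End InnerProductInequalities.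

(** * Inexact accelerated proximal point method *)

Section AcceleratedProximalPoint.
Variables (R : realFieldType) (m n : nat).
Variables (K : 'rV[R]_m -> 'rV[R]_n -> R) (P : 'rV[R]_n -> 'rV[R]_m -> 'rV[R]_n -> Prop).
Variables (lam alpha kap : R).
Hypotheses (lam_gt0 : 0 < lam) (alpha_gt0 : 0 < alpha) (alpha_le : alpha * 2 <= 1).
Implicit Types (w : 'rV[R]_m) (u v y z : 'rV[R]_n).

(* [(w, u)] solves the saddle problem max_w min_u K w u + lam/2 |u - z|^2,    *)
(* with [alpha ^+ 2 * lam] for the strong convexity of [K] in [u]; [P] keeps  *)
(* track of the first-order equations that characterize the solution.         *)
Definition prox_saddle z w u : Prop :=
  [/\ P z w u, forall w', K w' u <= K w u &
   forall u', K w u + lam * dot (z - u) (u' - u) + alpha ^+ 2 * lam / 2 * sqn (u' - u)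
     <= K w u'].

(** Along proximal points, [K w u] thus behaves like the strongly convex function max_w K w u with
    subgradient lam (z - u), so the analysis for a single function applies. *)
Lemma prox_saddle_le z w u z' w' u' :
  prox_saddle z w u -> prox_saddle z' w' u' ->
  K w u + lam * dot (z - u) (u' - u) + alpha ^+ 2 * lam / 2 * sqn (u' - u) <= K w' u'.
Proof. by move=> [_ _ h] [_ h' _]; apply: le_trans (h u') (h' w). Qed.

Variables (ws : 'rV[R]_m) (us : 'rV[R]_n).
Hypothesis (sol : prox_saddle us ws us).

Lemma prox_saddle_gap z w u :
  prox_saddle z w u -> alpha ^+ 2 * lam / 2 * sqn (u - us) <= K w u - K ws us.
Proof.
by move=> /(prox_saddle_le sol); rewrite subrr dot0l mulr0 addr0 lerBrDl.
Qed.

(** Comparing the two saddle points in both directions shows that the angle at [u] between [z] and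
    [us] is not acute. *)
Lemma prox_saddle_nonexp z w u :
  prox_saddle z w u -> sqn (z - u) + sqn (u - us) <= sqn (z - us).
Proof.
move=> p; have h1 := prox_saddle_gap p; have h2 := prox_saddle_le p sol.
have q0 : 0 <= alpha ^+ 2 * lam / 2.
  by rewrite divr_ge0 // mulr_ge0 ?sqr_ge0 // ltW.
have {h1 h2 q0} : lam * dot (z - u) (us - u) <= 0.
  have := mulr_ge0 q0 (sqn_ge0 (u - us)); have := mulr_ge0 q0 (sqn_ge0 (us - u)).
  lra.
rewrite pmulr_rle0 //; dot_expand => h; lra.
Qed.

(* [u0 + e] is the actual iterate and [u0] the exact proximal point it        *)
(* approximates; the error [e] is paid by the term - lam/4 |z - u|^2.         *)
Lemma accelerated_step z0 w0 u0 e v w u :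
  let z := (1 + alpha)^-1 *: (u0 + e + alpha *: v) in
  prox_saddle z0 w0 u0 -> prox_saddle z w u ->
  K w u - K ws us + alpha ^+ 2 * lam / 2 *
     sqn ((1 - alpha) *: v + alpha *: u + alpha^-1 *: (u - z) - us)
  <= (1 - alpha) * (K w0 u0 - K ws us + alpha ^+ 2 * lam / 2 * sqn (v - us))
     + lam * sqn e.
Proof.
have [[al0 al2] l0] := (alpha_gt0, alpha_le, lam_gt0).
move=> z p0 p; have h1 := prox_saddle_le p p0; have h2 := prox_saddle_le p sol.
have q0 : 0 <= alpha ^+ 2 * lam / 2.
  by rewrite divr_ge0 // mulr_ge0 ?sqr_ge0 // ltW.
have {}h1 : K w u + lam * dot (z - u) (u0 - u) <= K w0 u0.
  by have := mulr_ge0 q0 (sqn_ge0 (u0 - u)); lra.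
have a10 : 1 + alpha != 0 by rewrite gt_eqF // addr_gt0.
(* Coordinates centred at [us]; the definition of [z] eliminates [u0]. *)
pose b := v - us; pose c := u - us; pose s := z - us.
have ev : v - us = b by []. 
have e0 : u0 = us + ((1 + alpha) *: s - e - alpha *: b).
  rewrite /s /b /z scalerBr scalerA mulfV // scale1r; apply/rowP => i.
  by rewrite !mxE; ring.
have eu : u = us + c by rewrite addrC subrK.
have ez : z = us + s by rewrite addrC subrK.
have an0 : alpha != 0 by rewrite gt_eqF.
have -> : alpha ^+ 2 * lam / 2 *
     sqn ((1 - alpha) *: v + alpha *: u + alpha^-1 *: (u - z) - us) =
   lam / 2 * sqn ((alpha * (1 - alpha)) *: b + alpha ^+ 2 *: c + c - s).
  rewrite [RHS](_ : _ = lam / 2 * sqn (alpha *: ((1 - alpha) *: v + alpha *: u + alpha^-1 *: (u - z) - us))).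
    by rewrite sqnZ; field.
  congr (_ * sqn _); rewrite /b /c /s; apply/rowP => i; rewrite !mxE.
  by field; rewrite an0 a10.
have d1 : z - u = s - c by rewrite ez eu; apply/rowP => i; rewrite !mxE; ring.
have d2 : u0 - u = (1 + alpha) *: s - e - alpha *: b - c.
  by rewrite e0 eu; apply/rowP => i; rewrite !mxE; ring.
have d3 : us - u = - c by rewrite eu; apply/rowP => i; rewrite !mxE; ring.
rewrite d1 d2 in h1; rewrite d1 d3 in h2; rewrite ev.
have a1 : 0 <= 1 - alpha by lra.
have {}h1 := ler_wpM2l a1 h1; have {}h2 := ler_wpM2l (ltW alpha_gt0) h2.
(* The slack of (1 - alpha) h1 + alpha h2: a convexity defect between [b] and [c], a completed
   square for the cross term of [e] with s - c, and remainders that are nonnegative since alpha <=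
   1/2. *)
have key : 0 <= lam * (alpha ^+ 3 * (1 - alpha) / 2 * sqn (b - c)
   + sqn (2^-1 *: (s - c) - (1 - alpha) *: e) + (4^-1 - alpha ^+ 2) * sqn (s - c)
   + (1 - (1 - alpha) ^+ 2) * sqn e).
  apply: mulr_ge0; first exact: ltW.
  rewrite !addr_ge0 ?sqn_ge0 // mulr_ge0 ?sqn_ge0 //.
  - by rewrite divr_ge0 // mulr_ge0 // exprn_ge0 // ltW.
  - have h : 0 <= (1 - alpha * 2) * (1 + alpha * 2) by apply: mulr_ge0; lra.
    lra.
  - have h : 0 <= alpha * (2 - alpha) by apply: mulr_ge0; lra.
    lra.
clearbody b c s; move: h1 h2 key; rewrite /sqn !dotE ?(dotC c b) ?(dotC s b) ?(dotC e b).
rewrite ?(dotC s c) ?(dotC e c) ?(dotC e s) => h1 h2 key.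
lra.
Qed.

(* Values are measured at the exact proximal point [(w0, u0)] and not at the  *)
(* iterate [(w, y)], so no smoothness of [K] is needed; the last term tracks  *)
(* the distance between the two.                                              *)
Definition energy (w w0 : 'rV[R]_m) (y u0 v : 'rV[R]_n) : R :=
  K w0 u0 - K ws us + alpha ^+ 2 * lam / 2 * sqn (v - us)
  + 4 * lam * (sqn (w - w0) + sqn (y - u0)).

(** [kap] is a squared Lipschitz constant of the non-accelerated block as a function of the
    accelerated one. *)
Hypothesis (kap_ge0 : 0 <= kap).
Hypothesis (kapP : forall z w u z' w' u', prox_saddle z w u ->
  prox_saddle z' w' u' -> sqn (w - w') <= kap * sqn (u - u')).

Lemma quad_gt0 : 0 < alpha ^+ 2 * lam / 2.
Proof. by rewrite divr_gt0 // mulr_gt0 // exprn_gt0. Qed.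

(** This is why relative accuracy suffices: the initial distance of the next subproblem is bounded
    by the current errors and energy, so a relative error is a fraction of the energy. *)
Lemma prox_input_bound z0 w0 u0 w y v z W U :
  z = (1 + alpha)^-1 *: (y + alpha *: v) ->
  prox_saddle z0 w0 u0 -> prox_saddle z W U ->
  sqn (w - W) + sqn (z - U) <= 12 * (1 + kap) *
    (sqn (w - w0) + sqn (y - u0) +
     (K w0 u0 - K ws us + alpha ^+ 2 * lam / 2 * sqn (v - us))
       / (alpha ^+ 2 * lam / 2)).
Proof.
move=> ez p0 p; have g0 := prox_saddle_gap p0; have q0 := quad_gt0.
have k0 := kap_ge0; have al0 := alpha_gt0.
have nx := prox_saddle_nonexp p.
set e := _ / _.
have ee : sqn (u0 - us) + sqn (v - us) <= e.
  by rewrite /e ler_pdivlMr // mulrDl [_ * (_ / 2)]mulrC; lra.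
(* [z] is a convex combination of [y] and [v]. *)
have zb : sqn (z - us) <= sqn (y - us) + sqn (v - us).
  have a10 : 1 + alpha != 0 by rewrite gt_eqF // addr_gt0.
  have -> : z - us = (1 + alpha)^-1 *: ((y - us) + alpha *: (v - us)).
    by rewrite ez; apply/rowP => i; rewrite !mxE; field.
  rewrite sqnZ exprVn mulrC ler_pdivrMr ?exprn_gt0 ?addr_gt0 //.
  have h1 := sqn_ge0 (y - us - (v - us)); have h2 := sqn_ge0 (v - us).
  have h3 := sqn_ge0 (y - us).
  apply: (@le_trans _ _ ((1 + alpha) * (sqn (y - us) + alpha * sqn (v - us)))).
    have : 0 <= alpha * sqn (y - us - (v - us)) by apply: mulr_ge0 => //; lra.
    by move: (y - us) (v - us) => a b; dot_expand => h; lra.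
  have : 0 <= sqn (v - us) * (1 + alpha) + alpha * (1 + alpha) * sqn (y - us).
    by rewrite addr_ge0 // ?mulr_ge0 //; lra.
  by move=> h; rewrite expr2; nra.
have yb := sqn_triangle y u0 us.
have wb := sqn_triangle w w0 W.
have kb := kapP p0 p.
have ub := sqn_triangle u0 us U; rewrite (sqnBC us U) in ub.
have n1 := sqn_ge0 (w - w0); have n2 := sqn_ge0 (y - u0).
have n3 := sqn_ge0 (u0 - us); have n4 := sqn_ge0 (v - us).
have n5 := sqn_ge0 (U - us); have n6 := sqn_ge0 (z - U).
have kb2 : sqn (w0 - W) <= kap * (2 * e + 4 * (sqn (y - u0) + e)).
  by apply: le_trans kb _; rewrite ler_wpM2l //; lra.
have kb3 : 0 <= kap * sqn (w - w0) by apply: mulr_ge0.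
have kb4 : 0 <= kap * sqn (y - u0) by apply: mulr_ge0.
have kb5 : 0 <= kap * e by apply: mulr_ge0 => //; lra.
lra.
Qed.

(** The exact step contracts by 1 - alpha. Half of this decay pays for replacing [U] by [y1] in the
    update of [v]; the old error costs at most 2 lam of its weight 4 lam in the energy. *)
Lemma energy_step z0 w0 u0 w y v z W U w1 y1 r :
  z = (1 + alpha)^-1 *: (y + alpha *: v) ->
  prox_saddle z0 w0 u0 -> prox_saddle z W U ->
  0 <= r -> r * 2048 * (1 + kap) <= alpha ^+ 4 ->
  sqn (w1 - W) + sqn (y1 - U) <= r * (sqn (w - W) + sqn (z - U)) ->
  energy w1 W y1 U ((1 - alpha) *: v + alpha *: y1 + alpha^-1 *: (y1 - z))
  <= (1 - alpha / 2) * energy w w0 y u0 v.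
Proof.
move=> ez p0 p r0 rle hr; have ib := prox_input_bound w ez p0 p.
have [[al0 al2] l0] := (alpha_gt0, alpha_le, lam_gt0).
have [al3 al4] : 0 <= 1 - alpha * 2 /\ 0 <= 1 + alpha * 2 by split; lra.
have q0 := quad_gt0; have k0 := kap_ge0.
have g0 := prox_saddle_gap p0; have g1 := prox_saddle_gap p.
have y0e : y = u0 + (y - u0) by rewrite addrC subrK.
have := @accelerated_step z0 w0 u0 (y - u0) v W U; rewrite -y0e -ez.
move=> /(_ p0 p); rewrite /energy.
set vh := (X in sqn (X - us)) => st.
set v1 := (X in sqn (X - us)).
have vd : v1 - us = (vh - us) + (alpha + alpha^-1) *: (y1 - U).
  by rewrite /v1 /vh; apply/rowP => i; rewrite !mxE; ring.
have a4 : 0 < alpha / 4 by rewrite divr_gt0.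
have an0 : alpha != 0 by rewrite gt_eqF.
(* The parameter alpha/4 gives up only a quarter of the decay; the other term costs about alpha^-3,
   which the factor alpha^4 in the bound on [r] compensates. *)
have := sqnD_le (vh - us) ((alpha + alpha^-1) *: (y1 - U)) a4.
rewrite -vd sqnZ => vb.
set E := K w0 u0 - K ws us + alpha ^+ 2 * lam / 2 * sqn (v - us) in ib st *.
set eps := sqn (w - w0) + sqn (y - u0) in ib *.
set eps1 := sqn (w1 - W) + sqn (y1 - U) in hr *.
have E0 : 0 <= E.
  have h1 := mulr_ge0 (ltW q0) (sqn_ge0 (u0 - us)).
  by have h2 := mulr_ge0 (ltW q0) (sqn_ge0 (v - us)); rewrite /E; lra.
have eps0 : 0 <= eps by rewrite addr_ge0 ?sqn_ge0.
have eps10 : 0 <= eps1 by rewrite addr_ge0 ?sqn_ge0.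
have F0 : 0 <= K W U - K ws us.
  by apply: le_trans g1; rewrite mulr_ge0 ?sqn_ge0 // ltW.
have e1 : 128 * eps1 <= alpha ^+ 4 * (eps + E / (alpha ^+ 2 * lam / 2)).
  have {}hr : eps1 <= r * (12 * (1 + kap) * (eps + E / (alpha ^+ 2 * lam / 2))).
    by apply: le_trans hr _; rewrite ler_wpM2l.
  have s0 : 0 <= eps + E / (alpha ^+ 2 * lam / 2).
    by rewrite addr_ge0 // divr_ge0 // ltW.
  apply: (@le_trans _ _ (r * 2048 * (1 + kap) * (eps + E / (alpha ^+ 2 * lam / 2)))).
    have : 0 <= r * (1 + kap) * (eps + E / (alpha ^+ 2 * lam / 2)).
      by rewrite mulr_ge0 // mulr_ge0 // addr_ge0.
    by lra.
  by rewrite ler_wpM2r.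
have e2 : 128 * (lam * eps1 / alpha) <= alpha ^+ 3 * lam * eps + 2 * alpha * E.
  have -> : alpha ^+ 3 * lam * eps + 2 * alpha * E =
    lam / alpha * (alpha ^+ 4 * (eps + E / (alpha ^+ 2 * lam / 2))).
    by field; rewrite an0 gt_eqF.
  rewrite [X in X <= _](_ : _ = lam / alpha * (128 * eps1)); last by ring.
  by rewrite ler_wpM2l // divr_ge0 // ltW.
have vb2 : alpha ^+ 2 * lam / 2 * sqn (v1 - us) <=
   (1 + alpha / 4) * (alpha ^+ 2 * lam / 2 * sqn (vh - us)) + 10 * (lam * eps1 / alpha).
  have b1 : sqn (y1 - U) <= eps1 by rewrite lerDr sqn_ge0.
  have c0 : 0 <= (1 + (alpha / 4)^-1) * (alpha + alpha^-1) ^+ 2.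
    by rewrite mulr_ge0 ?sqr_ge0 // addr_ge0 // invr_ge0 ltW.
  have := ler_wpM2l (ltW q0) vb; have := ler_wpM2l (ltW q0) (ler_wpM2l c0 b1).
  have : alpha ^+ 2 * lam / 2 * ((1 + (alpha / 4)^-1) * (alpha + alpha^-1) ^+ 2 * eps1)
    <= 10 * (lam * eps1 / alpha).
    have -> : alpha ^+ 2 * lam / 2 * ((1 + (alpha / 4)^-1) * (alpha + alpha^-1) ^+ 2 * eps1)
     = lam * eps1 / alpha * ((alpha + 4) * (1 + alpha ^+ 2) ^+ 2 / 2) by field.
    rewrite [X in _ <= X]mulrC ler_wpM2l //.
      by rewrite divr_ge0 ?mulr_ge0 // ltW.
    have a1 : alpha ^+ 2 <= 4^-1 by rewrite -[_^-1]mul1r ler_pdivlMr //; nra.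
    have a2 : (1 + alpha ^+ 2) ^+ 2 <= 25 / 16.
      have -> : 25 / 16 = (1 + 4^-1) ^+ 2 :> R by field.
      by rewrite lerXn2r ?nnegrE ?addr_ge0 ?sqr_ge0 // ?lerD2l // invr_ge0.
    have : 0 <= (1 + alpha ^+ 2) ^+ 2 by rewrite sqr_ge0.
    by nra.
  by lra.
have l1 : 0 <= lam * eps by rewrite mulr_ge0 // ltW.
have l2 : 0 <= lam * eps1 by rewrite mulr_ge0 // ltW.
have aE : 0 <= alpha * E by rewrite mulr_ge0 // ltW.
have l3 : 4 * lam * eps1 <= 2 * (lam * eps1 / alpha).
  rewrite mulrA ler_pdivlMr //; nra.
have st2 : (1 + alpha / 4) * (K W U - K ws us + alpha ^+ 2 * lam / 2 * sqn (vh - us))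
  <= (1 - 3 * alpha / 4) * E + 2 * (lam * eps).
  have c0 : 0 <= 1 + alpha / 4 by rewrite addr_ge0 // ltW.
  have s1 : sqn (y - u0) <= eps by rewrite lerDr sqn_ge0.
  have s2 : K W U - K ws us + alpha ^+ 2 * lam / 2 * sqn (vh - us)
     <= (1 - alpha) * E + lam * eps.
    by apply: le_trans st _; rewrite lerD2l ler_wpM2l // ltW.
  apply: le_trans (ler_wpM2l c0 s2) _.
  have : 0 <= alpha ^+ 2 * E by rewrite mulr_ge0 // sqr_ge0.
  by nra.
have a3 : alpha ^+ 3 * (lam * eps) <= alpha / 4 * (lam * eps).
  rewrite ler_wpM2r //; have : 0 <= alpha * ((1 - alpha * 2) * (1 + alpha * 2)).
    exact: mulr_ge0 (ltW al0) (mulr_ge0 al3 al4).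
  by lra.
have aF : 0 <= alpha / 4 * (K W U - K ws us) by rewrite mulr_ge0 // ltW.
have al : alpha * (lam * eps) <= lam * eps / 2.
  by have := mulr_ge0 al3 l1; lra.
by lra.
Qed.

(** With [v] started at [y], the first proximal step turns plain distance into energy, so no bound
    on initial function values is needed. *)
Lemma energy_init w y W U w1 y1 r :
  prox_saddle y W U -> 0 <= r -> r * 2048 * (1 + kap) <= 1 ->
  sqn (w1 - W) + sqn (y1 - U) <= r * (sqn (w - W) + sqn (y - U)) ->
  energy w1 W y1 U y <= lam * (sqn (w - ws) + sqn (y - us)).
Proof.
move=> p r0 rle hr; have g := prox_saddle_gap p; have := prox_saddle_le p sol.
have [[al0 al2] l0] := (alpha_gt0, alpha_le, lam_gt0).
have [al3 al4] : 0 <= 1 - alpha * 2 /\ 0 <= 1 + alpha * 2 by split; lra.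
have q0 := quad_gt0; have k0 := kap_ge0.
have nx := prox_saddle_nonexp p; have kb := kapP p sol.
have wb := sqn_triangle w ws W; rewrite (sqnBC ws W) in wb.
have n1 := sqn_ge0 (w - ws); have n2 := sqn_ge0 (y - us).
have n3 := sqn_ge0 (U - us); have n4 := sqn_ge0 (y - U).
have kb2 : sqn (W - ws) <= kap * sqn (y - us).
  by apply: le_trans kb _; rewrite ler_wpM2l //; lra.
have D0 : 0 <= sqn (w - ws) + sqn (y - us) by rewrite addr_ge0.
have k1 : 0 <= kap * sqn (w - ws) by apply: mulr_ge0.
have e1 : 512 * (sqn (w1 - W) + sqn (y1 - U)) <= sqn (w - ws) + sqn (y - us).
  have h : sqn (w - W) + sqn (y - U) <= 2 * (1 + kap) * (sqn (w - ws) + sqn (y - us)).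
    by lra.
  have h2 := le_trans hr (ler_wpM2l r0 h); have h3 := ler_wpM2r D0 rle.
  have h4 : 0 <= r * (1 + kap) * (sqn (w - ws) + sqn (y - us)).
    by rewrite mulr_ge0 // mulr_ge0 // addr_ge0.
  by lra.
have dt : dot (y - U) (us - U) = - dot ((y - us) - (U - us)) (U - us).
  by dot_expand; ring.
rewrite dt; move=> h.
have h1 : dot ((y - us) - (U - us)) (U - us) <= sqn (y - us) / 4.
  have := sqn_ge0 (2^-1 *: (y - us) - (U - us)); move: (y - us) (U - us) => a b.
  by dot_expand => h1; lra.
have q1 : 0 <= alpha ^+ 2 * lam / 2 * sqn (us - U) by rewrite mulr_ge0 ?sqn_ge0 // ltW.
have q2 : alpha ^+ 2 * lam / 2 * sqn (y - us) <= lam / 8 * sqn (y - us).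
  rewrite ler_wpM2r //; have : 0 <= lam * ((1 - alpha * 2) * (1 + alpha * 2)).
    exact: mulr_ge0 (ltW l0) (mulr_ge0 al3 al4).
  by lra.
have h2 := ler_wpM2l (ltW l0) h1; have h3 := ler_wpM2l (ltW l0) e1.
have h4 := mulr_ge0 (ltW l0) n2; have h5 := mulr_ge0 (ltW l0) n1.
by rewrite /energy; lra.
Qed.

Lemma energy_dist z w y v W U : prox_saddle z W U ->
  sqn (w - ws) + sqn (y - us) <= 4 * (1 + kap) / (alpha ^+ 2 * lam) * energy w W y U v.
Proof.
move=> p; have g := prox_saddle_gap p.
have [[al0 al2] l0] := (alpha_gt0, alpha_le, lam_gt0).
have q0 := quad_gt0; have k0 := kap_ge0; have kb := kapP p sol.
have := mulr_ge0 (ltW q0) (sqn_ge0 (v - us)) => vs.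
have eps0 : 0 <= sqn (w - W) + sqn (y - U) by rewrite addr_ge0 ?sqn_ge0.
have a2 : 0 <= lam * (1 - alpha ^+ 2) by rewrite mulr_ge0 //; [lra|nra].
have ub : sqn (U - us) + (sqn (w - W) + sqn (y - U))
    <= energy w W y U v / (alpha ^+ 2 * lam / 2).
  rewrite ler_pdivlMr // mulrC /energy.
  by have := mulr_ge0 a2 eps0; have := mulr_ge0 (ltW l0) eps0; lra.
have wt := sqn_triangle w W ws; have yt := sqn_triangle y U us.
have kb2 : sqn (W - ws) <= kap * (energy w W y U v / (alpha ^+ 2 * lam / 2)).
  by apply: le_trans kb _; rewrite ler_wpM2l //; lra.
have -> : 4 * (1 + kap) / (alpha ^+ 2 * lam) * energy w W y U v =
  2 * (1 + kap) * (energy w W y U v / (alpha ^+ 2 * lam / 2)).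
  by field; rewrite !gt_eqF.
by lra.
Qed.
End AcceleratedProximalPoint.

(** * Oracle routines and their cost *)

(* Subroutines in continuation-passing style: [algorithm X Y] only returns    *)
(* elements of Y, while the inner procedures return pairs.                    *)
Definition routine (X Y Z : Type) := (Z -> algorithm X Y) -> algorithm X Y.

Section Routines.
Variables (X Y : Type) (of_ : X -> X) (oh : Y -> Y) (ox : X -> Y -> X) (oy : X -> Y -> Y).

Definition ret (Z : Type) (z : Z) : routine X Y Z := fun k => k z.

Definition bind (Z T : Type) (s : routine X Y Z) (g : Z -> routine X Y T) :
  routine X Y T := fun k => s (fun z => g z k).

Fixpoint iterate (Z : Type) (n : nat) (s : Z -> routine X Y Z) (z : Z) : routine X Y Z :=
  if n is n'.+1 then bind (iterate n' s z) s else ret z.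

(** Result and counts are chosen before the continuation [k], so costs add up under [bind]. One
    bound serves both oracles of G. *)
Definition computes (Z : Type) (s : routine X Y Z) (Q : Z -> Prop) (nf nh ng : nat) : Prop :=
  exists z a b c d,
    [/\ Q z, (a <= nf)%N, (b <= nh)%N, (maxn c d <= ng)%N &
        forall k, run_oracles of_ oh ox oy (s k) =
          let: Outcome y a' b' c' d' := run_oracles of_ oh ox oy (k z) in
          Outcome y (a + a') (b + b') (c + c') (d + d')].

Lemma computes_ret (Z : Type) (z : Z) (Q : Z -> Prop) : Q z -> computes (ret z) Q 0 0 0.
Proof. by move=> Qz; exists z, 0%N, 0%N, 0%N, 0%N; split=> // k; rewrite /ret; case: run_oracles. Qed.

Lemma computes_bind (Z T : Type) (s : routine X Y Z) (g : Z -> routine X Y T)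
    (Q : Z -> Prop) (Q' : T -> Prop) nf nh ng nf' nh' ng' :
  computes s Q nf nh ng -> (forall z, Q z -> computes (g z) Q' nf' nh' ng') ->
  computes (bind s g) Q' (nf + nf') (nh + nh') (ng + ng').
Proof.
move=> [z [a [b [c [d [Qz ha hb]]]]]]; rewrite geq_max => /andP[hc hd] e h.
have [z' [a' [b' [c' [d' [Qz' ha' hb']]]]]] := h z Qz.
rewrite geq_max => /andP[hc' hd'] e'.
exists z', (a + a')%N, (b + b')%N, (c + c')%N, (d + d')%N; split=> //.
- exact: leq_add.
- exact: leq_add.
- by rewrite geq_max !leq_add.
- by move=> k; rewrite /bind e e'; case: run_oracles => *; rewrite !addnA.
Qed.

Lemma computes_weaken (Z : Type) (s : routine X Y Z) (Q Q' : Z -> Prop) nf nh ng nf' nh' ng' :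
  (forall z, Q z -> Q' z) -> (nf <= nf')%N -> (nh <= nh')%N -> (ng <= ng')%N ->
  computes s Q nf nh ng -> computes s Q' nf' nh' ng'.
Proof.
move=> QQ hf hh hg [z [a [b [c [d [Qz ha hb hc e]]]]]].
exists z, a, b, c, d; split=> //; first exact: QQ.
- exact: leq_trans hf.
- exact: leq_trans hh.
- exact: leq_trans hg.
Qed.

Lemma computes_iterate (Z : Type) (I : nat -> Z -> Prop) (s : Z -> routine X Y Z) nf nh ng n z :
  (forall i z, I i z -> computes (s z) (I i.+1) nf nh ng) ->
  I 0%N z -> computes (iterate n s z) (I n) (n * nf) (n * nh) (n * ng).
Proof.
move=> hs Iz; elim: n => [|n IHn]; first exact: computes_ret.
by rewrite !mulSnr; apply: computes_bind IHn _ => z'; apply: hs.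
Qed.

Lemma computes_f x :
  computes (fun k => Query_f x k) (fun g => g = of_ x) 1 0 0.
Proof.
by exists (of_ x), 1%N, 0%N, 0%N, 0%N; split=> //= k; case: run_oracles.
Qed.

Lemma computes_h y :
  computes (fun k => Query_h y k) (fun g => g = oh y) 0 1 0.
Proof.
by exists (oh y), 0%N, 1%N, 0%N, 0%N; split=> //= k; case: run_oracles.
Qed.

Lemma computes_G x y :
  computes (fun k => Query_Gx x y (fun u => Query_Gy x y (fun v => k (u, v))))
    (fun g => g = (ox x y, oy x y)) 0 0 1.
Proof.
by exists (ox x y, oy x y), 0%N, 0%N, 1%N, 1%N; split=> //= k; case: run_oracles.
Qed.

End Routines.

(** * The accelerated loop as an oracle routine *)

Section Catalyst.
Variables (R : realType) (X Y : Type) (m n : nat).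
Implicit Types (w : 'rV[R]_m) (z y v : 'rV[R]_n).

(* The first argument is the warm start of the non-accelerated block, the     *)
(* second one is the proximal center of the accelerated block.                *)
Definition catalyst (s : 'rV[R]_m -> 'rV[R]_n -> routine X Y ('rV[R]_m * 'rV[R]_n))
    (alpha : R) (N : nat) w y : routine X Y ('rV[R]_m * 'rV[R]_n) :=
  bind (s w y) (fun o =>
  bind (iterate N (fun wyv : 'rV[R]_m * 'rV[R]_n * 'rV[R]_n =>
    let: (w, y, v) := wyv in
    let z := (1 + alpha)^-1 *: (y + alpha *: v) in
    bind (s w z) (fun o => ret (o.1, o.2,
      (1 - alpha) *: v + alpha *: o.2 + alpha^-1 *: (o.2 - z)))) (o.1, o.2, y))
  (fun wyv => ret wyv.1)).

Lemma computes_catalyst (of_ : X -> X) (oh : Y -> Y) (ox : X -> Y -> X) (oy : X -> Y -> Y)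
    s (alpha lam kap r : R) (K : 'rV[R]_m -> 'rV[R]_n -> R)
    (P : 'rV[R]_n -> 'rV[R]_m -> 'rV[R]_n -> Prop) ws us nf nh ng N w0 y0 :
  0 < lam -> 0 < alpha -> alpha * 2 <= 1 -> 0 <= kap ->
  prox_saddle K P lam alpha us ws us ->
  (forall z w u z' w' u', prox_saddle K P lam alpha z w u ->
     prox_saddle K P lam alpha z' w' u' -> sqn (w - w') <= kap * sqn (u - u')) ->
  (forall z, exists w u, prox_saddle K P lam alpha z w u) ->
  0 <= r -> r * 2048 * (1 + kap) <= alpha ^+ 4 ->
  (forall w z W U, prox_saddle K P lam alpha z W U ->
     computes of_ oh ox oy (s w z)
       (fun o => sqn (o.1 - W) + sqn (o.2 - U) <= r * (sqn (w - W) + sqn (z - U))) nf nh ng) ->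
  computes of_ oh ox oy (catalyst s alpha N w0 y0)
    (fun o => sqn (o.1 - ws) + sqn (o.2 - us) <=
      4 * (1 + kap) / alpha ^+ 2 * (1 - alpha / 2) ^+ N * (sqn (w0 - ws) + sqn (y0 - us)))
    (N.+1 * nf) (N.+1 * nh) (N.+1 * ng).
Proof.
move=> l0 al0 al2 k0 sol kapP ex r0 rle hs.
have [W0 [U0 p0]] := ex y0.
have r1 : r * 2048 * (1 + kap) <= 1.
  by apply: le_trans rle _; rewrite exprn_ile1 // ?ltW //; lra.
set D := sqn (w0 - ws) + sqn (y0 - us).
(* The exact proximal pair is unknown to the routine and lives only in the invariant. *)
pose I i (wyv : 'rV[R]_m * 'rV[R]_n * 'rV[R]_n) := exists z W U,
  prox_saddle K P lam alpha z W U /\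
  energy K lam alpha ws us wyv.1.1 W wyv.1.2 U wyv.2 <= (1 - alpha / 2) ^+ i * (lam * D).
rewrite !mulSn; apply: computes_bind (hs w0 y0 _ _ p0) _ => -[w1 y1] /= h1.
rewrite -[(N * nf)%N]addn0 -[(N * nh)%N]addn0 -[(N * ng)%N]addn0.
apply: (@computes_bind _ _ _ _ _ _ _ _ _ _ (I N)).
  apply: computes_iterate; last first.
    exists y0, W0, U0; split=> //=; rewrite expr0 mul1r.
    exact: (energy_init l0 al0 al2 sol k0 kapP p0 r0 r1).
  move=> i [[w y] v] [z' [W' [U' [/= p' e']]]].
  set z := (1 + alpha)^-1 *: _.
  have [W [U p]] := ex z.
  rewrite -[nf]addn0 -[nh]addn0 -[ng]addn0.
  apply: computes_bind (hs w z _ _ p) _ => -[w2 y2] /= h2.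
  apply: computes_ret; exists z, W, U; split=> //=.
  apply: le_trans (energy_step l0 al0 al2 sol k0 kapP (erefl z) p' p r0 rle h2) _.
  by rewrite exprS -mulrA ler_wpM2l //; lra.
move=> [[w y] v] [z [W [U [/= p e]]]]; apply: computes_ret => /=.
apply: le_trans (energy_dist l0 al0 al2 sol k0 kapP w y v p) _.
have q0 : 0 <= 4 * (1 + kap) / (alpha ^+ 2 * lam).
  by rewrite divr_ge0 // mulr_ge0 ?exprn_ge0 ?addr_ge0 // ltW.
apply: le_trans (ler_wpM2l q0 e) _.
rewrite le_eqVlt; apply/orP; left; apply/eqP; field.
by rewrite !gt_eqF.
Qed.

End Catalyst.

(** * Roots of strongly monotone operators *)

Section RootExistence.
Variables (R : realType) (n : nat).

Lemma norm_sqn (x : 'rV[R]_n) : `|x| ^+ 2 <= sqn x <= n%:R * `|x| ^+ 2.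
Proof.
apply/andP; split.
  rewrite -ler_sqrt ?sqn_ge0 // sqrtr_sqr normr_id.
  rewrite [leLHS]/Num.norm /= mx_normrE; apply/bigmax_leP => /=; split=> [|[i j] _ /=].
    exact: sqrtr_ge0.
  rewrite -sqrtr_sqr ler_sqrt ?sqn_ge0 // /sqn /dot (bigD1 j) //= ord1 -expr2.
  by rewrite lerDl sumr_ge0 // => k _; rewrite -expr2 sqr_ge0.
rewrite /sqn /dot mulr_natl -[X in _ *+ X](card_ord n) -sumr_const ler_sum // => i _.
rewrite -expr2 -real_normK ?num_real // lerXn2r ?nnegrE //.
by rewrite [leRHS]/Num.norm /= mx_normrE; apply/bigmax_geP; right => /=; exists (0, i).
Qed.

(** A damped step along F - p contracts the Euclidean norm. Banach's theorem is applied in the sup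
    norm, to an iterate high enough to absorb the factor n between the squared norms. *)
Lemma strongly_monotone_root (F : 'rV[R]_n -> 'rV[R]_n) (m L : R) :
  0 < m -> 0 < L ->
  (forall x y, m * sqn (x - y) <= dot (F x - F y) (x - y)) ->
  (forall x y, sqn (F x - F y) <= L * sqn (x - y)) ->
  forall p, exists x, F x = p.
Proof.
move=> m0 L0 Fm FL p.
have Lm0 : 0 < L + m ^+ 2 by rewrite addr_gt0 // exprn_gt0.
pose eta := m / (L + m ^+ 2); pose c := L / (L + m ^+ 2).
pose T x := x - eta *: (F x - p).
have c0 : 0 <= c by rewrite divr_ge0 // ltW.
have Tc x y : sqn (T x - T y) <= c * sqn (x - y).
  have -> : T x - T y = (x - y) - eta *: (F x - F y).
    by rewrite /T; apply/rowP => i; rewrite !mxE; ring.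
  have -> : sqn (x - y - eta *: (F x - F y)) =
    sqn (x - y) - 2 * eta * dot (F x - F y) (x - y) + eta ^+ 2 * sqn (F x - F y).
    by move: (x - y) (F x - F y) => a b; dot_expand; ring.
  have e0 : 0 <= eta by rewrite divr_ge0 // ltW.
  have h1 := ler_wpM2l e0 (Fm x y); have h2 := ler_wpM2l (sqr_ge0 eta) (FL x y).
  have h3 : 0 <= eta ^+ 2 * m ^+ 2 * sqn (x - y).
    by apply: mulr_ge0 (sqn_ge0 _); apply: mulr_ge0; rewrite sqr_ge0.
  have -> : c = 1 - 2 * eta * m + eta ^+ 2 * L + eta ^+ 2 * m ^+ 2.
    by rewrite /c /eta; field; rewrite gt_eqF.
  by lra.
have Tk k x y : sqn (iter k T x - iter k T y) <= c ^+ k * sqn (x - y).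
  elim: k => [|k IH]; first by rewrite expr0 mul1r.
  apply: le_trans (Tc _ _) _; rewrite exprS -mulrA.
  by rewrite ler_wpM2l.
have [k ck] : exists k, c ^+ k * n%:R <= 4^-1.
  have c1 : `|c| < 1 by rewrite ger0_norm // ltr_pdivrMr // mul1r ltrDl exprn_gt0.
  have /cvgrPdist_le /(_ ((4 * n.+1%:R)^-1)) := cvg_expr c1.
  rewrite invr_gt0 mulr_gt0 // => /(_ isT) [k _ /(_ k (leqnn k)) /=].
  rewrite sub0r normrN ger0_norm ?exprn_ge0 // => h; exists k.
  apply: le_trans (ler_wpM2r _ h) _ => //.
  by rewrite invfM -mulrA ler_piMr ?invr_ge0 // mulrC ler_pdivrMr // mul1r ler_nat.
have Tk2 x y : `|iter k T x - iter k T y| <= 2^-1 * `|x - y|.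
  rewrite -ler_sqr ?nnegrE ?mulr_ge0 ?invr_ge0 // exprMn exprVn.
  have /andP[h1 _] := norm_sqn (iter k T x - iter k T y).
  have /andP[_ h2] := norm_sqn (x - y).
  apply: le_trans h1 _; apply: le_trans (Tk k x y) _.
  apply: le_trans (ler_wpM2l (exprn_ge0 k c0) h2) _; rewrite mulrA.
  by rewrite ler_wpM2r ?sqr_ge0 // (le_trans ck) // -natrX.
pose V := HB.pack_for (completeNormedModType R) 'rV[R]_n.
pose g : {fun [set: V] >-> [set: V]} := [fun of totalfun (iter k T)].
have [|||x _ xk] := @banach_fixed_point R V [set: V] g.
- exists (2^-1)%:nng; split=> /=; first by rewrite invf_lt1 // ltr1n.
  by move=> [x y] _ /=; exact: Tk2.
- exact: closedT.
- by exists (0 : 'rV[R]_n).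
have {}xk : iter k T x = x by rewrite [RHS]xk.
(* [T x] is also fixed by the contraction [iter k T], hence equals [x]. *)
have Tx : T x = x.
  have h := Tk k (T x) x; rewrite -iterSr iterS xk in h.
  have h2 := Tk2 (T x) x; rewrite -iterSr iterS xk in h2.
  have : `|T x - x| <= 0 by lra.
  by rewrite normr_le0 subr_eq0 => /eqP.
exists x; move/eqP: Tx; rewrite /T -subr_eq0 addrAC subrr add0r oppr_eq0 scaler_eq0.
rewrite subr_eq0 => /orP[|/eqP//].
by rewrite mulf_eq0 invr_eq0 !gt_eqF.
Qed.

End RootExistence.

(** * Regularized saddle operators *)

Record instance (R : realType) (dx dy : nat) := Instance {
  vf : 'rV[R]_dx -> R;
  vG : 'rV[R]_dx -> 'rV[R]_dy -> R;
  vh : 'rV[R]_dy -> R;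
  gf : 'rV[R]_dx -> 'rV[R]_dx;
  gh : 'rV[R]_dy -> 'rV[R]_dy;
  gx : 'rV[R]_dx -> 'rV[R]_dy -> 'rV[R]_dx;
  gy : 'rV[R]_dx -> 'rV[R]_dy -> 'rV[R]_dy }.

(** First-order inequalities replace differentiability: the solvers treat the gradients as plain
    maps, and [regular_instance] connects them to derivatives. *)
Record regular (R : realType) (dx dy : nat) (Lf LG Lh mux muy : R)
    (I : instance R dx dy) : Prop := Regular {
  f_convex : forall x x', vf I x + dot (gf I x) (x' - x) + mux / 2 * sqn (x' - x) <= vf I x';
  f_smooth : forall x x', sqn (gf I x - gf I x') <= Lf ^+ 2 * sqn (x - x');
  h_convex : forall y y', vh I y + dot (gh I y) (y' - y) + muy / 2 * sqn (y' - y) <= vh I y';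
  h_smooth : forall y y', sqn (gh I y - gh I y') <= Lh ^+ 2 * sqn (y - y');
  G_convex : forall x x' y, vG I x y + dot (gx I x y) (x' - x) <= vG I x' y;
  G_concave : forall x y y', vG I x y' <= vG I x y + dot (gy I x y) (y' - y);
  G_smooth : forall x y x' y',
    sqn (gx I x y - gx I x' y') + sqn (gy I x y - gy I x' y')
    <= LG ^+ 2 * (sqn (x - x') + sqn (y - y')) }.

Section Operators.
Variables (R : realType) (dx dy : nat).
Notation X := 'rV[R]_dx.
Notation Y := 'rV[R]_dy.
Implicit Types (I : instance R dx dy) (x p : X) (y q : Y).

(* Saddle value and monotone operator of the problem in which f, h, G are     *)
(* weighted by cf, ch, cG in {0, 1}, with the regularization                  *)
(* a/2 |x|^2 - <p, x> - b/2 |y|^2 + <q, y>; saddle points solve               *)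
(* opX = p and opY = q.                                                       *)
Definition value (cf ch cG a b : R) p q I x y : R :=
  cf * vf I x + cG * vG I x y - ch * vh I y + a / 2 * sqn x - b / 2 * sqn y
  - dot p x + dot q y.
Definition opX (cf cG a : R) I x y : X := cf *: gf I x + cG *: gx I x y + a *: x.
Definition opY (ch cG b : R) I x y : Y := ch *: gh I y - cG *: gy I x y + b *: y.

Variables (Lf LG Lh mux muy : R).
Hypothesis (Lf_gt0 : 0 < Lf).
Notation regular := (regular Lf LG Lh mux muy).
Variables (cf ch cG a b : R).
Hypotheses (cf01 : 0 <= cf <= 1) (ch01 : 0 <= ch <= 1) (cG01 : 0 <= cG <= 1).

Lemma value_convex p q I x x' y : regular I ->
  value cf ch cG a b p q I x y + dot (opX cf cG a I x y - p) (x' - x)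
    + (cf * mux + a) / 2 * sqn (x' - x) <= value cf ch cG a b p q I x' y.
Proof.
move=> rI; have /andP[c0 _] := cf01; have /andP[g0 _] := cG01.
have := ler_wpM2l c0 (f_convex rI x x'); have := ler_wpM2l g0 (G_convex rI x x' y).
rewrite /value /opX; dot_expand => h1 h2.
lra.
Qed.

Lemma value_concave p q I x y y' : regular I ->
  value cf ch cG a b p q I x y' <=
  value cf ch cG a b p q I x y - dot (opY ch cG b I x y - q) (y' - y)
    - (ch * muy + b) / 2 * sqn (y' - y).
Proof.
move=> rI; have /andP[c0 _] := ch01; have /andP[g0 _] := cG01.
have := ler_wpM2l c0 (h_convex rI y y'); have := ler_wpM2l g0 (G_concave rI x y y').
rewrite /value /opY; dot_expand => h1 h2.
lra.
Qed.

(** Two convexity and two concavity inequalities around the rectangle with corners (x, y) and (x',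
    y'); the four values cancel. *)
Lemma op_monotone I x y x' y' : regular I ->
  (cf * mux + a) * sqn (x - x') + (ch * muy + b) * sqn (y - y') <=
  dot (opX cf cG a I x y - opX cf cG a I x' y') (x - x') +
  dot (opY ch cG b I x y - opY ch cG b I x' y') (y - y').
Proof.
move=> rI.
have h1 := value_convex 0 0 x x' y rI; have h2 := value_convex 0 0 x' x y' rI.
have h3 := value_concave 0 0 x y y' rI; have h4 := value_concave 0 0 x' y' y rI.
rewrite -!(opprB x') -!(opprB y') !sqnN in h2 h4 *.
move: h1 h2 h3 h4; rewrite !subr0.
move: (opX _ _ _ _ _ _) (opX _ _ _ _ _ _) (opY _ _ _ _ _ _) (opY _ _ _ _ _ _) => u1 u2 u3 u4.
move: (sqn _) (sqn _) => s1 s2.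
rewrite !dotE => h1 h2 h3 h4.
lra.
Qed.

Lemma op_crossX I x y y' : regular I ->
  sqn (opX cf cG a I x y - opX cf cG a I x y') <= LG ^+ 2 * sqn (y - y').
Proof.
move=> rI; have := G_smooth rI x y x y'; rewrite subrr sqn0 add0r => h.
have -> : opX cf cG a I x y - opX cf cG a I x y' = cG *: (gx I x y - gx I x y').
  by rewrite /opX; apply/rowP => i; rewrite !mxE; ring.
rewrite sqnZ; have /andP[g0 g1] := cG01.
have h1 := sqn_ge0 (gx I x y - gx I x y'); have h2 := sqn_ge0 (gy I x y - gy I x y').
have : cG ^+ 2 * sqn (gx I x y - gx I x y') <= sqn (gx I x y - gx I x y').
  by rewrite ler_piMl // exprn_ile1.
lra.
Qed.

Lemma op_crossY I x x' y : regular I ->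
  sqn (opY ch cG b I x y - opY ch cG b I x' y) <= LG ^+ 2 * sqn (x - x').
Proof.
move=> rI; have := G_smooth rI x y x' y; rewrite subrr sqn0 addr0 => h.
have -> : opY ch cG b I x y - opY ch cG b I x' y = cG *: (gy I x' y - gy I x y).
  by rewrite /opY; apply/rowP => i; rewrite !mxE; ring.
rewrite sqnZ sqnBC; have /andP[g0 g1] := cG01.
have h1 := sqn_ge0 (gx I x y - gx I x' y); have h2 := sqn_ge0 (gy I x y - gy I x' y).
have : cG ^+ 2 * sqn (gy I x y - gy I x' y) <= sqn (gy I x y - gy I x' y).
  by rewrite ler_piMl // exprn_ile1.
lra.
Qed.

(** The best response in x is Lipschitz in y, by strong monotonicity in x; this provides [kap] for
    loops accelerated in y. *)
Lemma sensitivityX I x y x' y' p : regular I -> 0 < cf * mux + a ->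
  opX cf cG a I x y = p -> opX cf cG a I x' y' = p ->
  (cf * mux + a) ^+ 2 * sqn (x - x') <= LG ^+ 2 * sqn (y - y').
Proof.
move=> rI m0 e e'; set m := cf * mux + a in m0 *.
have := op_monotone x y x' y rI; rewrite subrr dot0r sqn0 mulr0 !addr0 -/m e -e' => h.
have h2 := op_crossX x' y' y rI; rewrite (sqnBC y') in h2; apply: le_trans h2.
have h3 := sqn_ge0 (m *: (x - x') - (opX cf cG a I x' y' - opX cf cG a I x' y)).
have h4 := ler_wpM2l (ltW m0) h.
move: h3 h4; move: (x - x') (opX _ _ _ _ _ _ - _) => u v.
by dot_expand => h3 h4; lra.
Qed.

Lemma sensitivityY I x y x' y' q : regular I -> 0 < ch * muy + b ->
  opY ch cG b I x y = q -> opY ch cG b I x' y' = q ->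
  (ch * muy + b) ^+ 2 * sqn (y - y') <= LG ^+ 2 * sqn (x - x').
Proof.
move=> rI m0 e e'; set m := ch * muy + b in m0 *.
have := op_monotone x y x y' rI; rewrite subrr dot0r sqn0 mulr0 !add0r -/m e -e' => h.
have h2 := op_crossY x' x y' rI; rewrite (sqnBC x') in h2; apply: le_trans h2.
have h3 := sqn_ge0 (m *: (y - y') - (opY ch cG b I x' y' - opY ch cG b I x y')).
have h4 := ler_wpM2l (ltW m0) h.
move: h3 h4; move: (y - y') (opY _ _ _ _ _ _ - _) => u v.
by dot_expand => h3 h4; lra.
Qed.

Lemma op_lipschitz I x y x' y' : regular I ->
  sqn (opX cf cG a I x y - opX cf cG a I x' y') +
  sqn (opY ch cG b I x y - opY ch cG b I x' y') <=
  3 * (Lf ^+ 2 + Lh ^+ 2 + LG ^+ 2 + a ^+ 2 + b ^+ 2) * (sqn (x - x') + sqn (y - y')).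
Proof.
move=> rI.
have sq3 n (u v w : 'rV[R]_n) : sqn (u + v + w) <= 3 * (sqn u + sqn v + sqn w).
  have := sqn_ge0 (u - v); have := sqn_ge0 (u - w); have := sqn_ge0 (v - w).
  by dot_expand => *; lra.
have sc n (c : R) (u : 'rV[R]_n) : 0 <= c <= 1 -> sqn (c *: u) <= sqn u.
  by move=> /andP[? ?]; rewrite sqnZ ler_piMl ?sqn_ge0 // exprn_ile1.
have -> : opX cf cG a I x y - opX cf cG a I x' y' = cf *: (gf I x - gf I x') +
    cG *: (gx I x y - gx I x' y') + a *: (x - x').
  by rewrite /opX; apply/rowP => i; rewrite !mxE; ring.
have -> : opY ch cG b I x y - opY ch cG b I x' y' = ch *: (gh I y - gh I y') +
    cG *: (- (gy I x y - gy I x' y')) + b *: (y - y').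
  by rewrite /opY; apply/rowP => i; rewrite !mxE; ring.
apply: le_trans (lerD (sq3 _ _ _ _) (sq3 _ _ _ _)) _.
have := f_smooth rI x x'; have := h_smooth rI y y'; have := G_smooth rI x y x' y'.
have := sc _ cf (gf I x - gf I x') cf01; have := sc _ ch (gh I y - gh I y') ch01.
have := sc _ cG (gx I x y - gx I x' y') cG01.
have := sc _ cG (- (gy I x y - gy I x' y')) cG01; rewrite sqnN.
rewrite (sqnZ a) (sqnZ b).
have hx := sqn_ge0 (x - x'); have hy := sqn_ge0 (y - y').
have := mulr_ge0 (sqr_ge0 a) hy; have := mulr_ge0 (sqr_ge0 b) hx.
have := mulr_ge0 (sqr_ge0 Lf) hy; have := mulr_ge0 (sqr_ge0 Lh) hx.
move: (sqn (x - x')) (sqn (y - y')) => s1 s2 *.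
lra.
Qed.

Lemma op_root I p q : regular I -> 0 < cf * mux + a -> 0 < ch * muy + b ->
  exists x y, opX cf cG a I x y = p /\ opY ch cG b I x y = q.
Proof.
move=> rI m1 m2.
pose F (z : 'rV[R]_(dx + dy)) := row_mx (opX cf cG a I (lsubmx z) (rsubmx z))
  (opY ch cG b I (lsubmx z) (rsubmx z)).
have dotrow (u u' : X) (v v' : Y) : dot (row_mx u v) (row_mx u' v') = dot u u' + dot v v'.
  rewrite /dot big_split_ord /=; congr (_ + _); apply: eq_bigr => i _.
    by rewrite !row_mxEl.
  by rewrite !row_mxEr.
have dotsplit (z z' : 'rV[R]_(dx + dy)) :
    dot z z' = dot (lsubmx z) (lsubmx z') + dot (rsubmx z) (rsubmx z').
  by rewrite -dotrow !hsubmxK.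
have Fsub z z' : F z - F z' = row_mx
    (opX cf cG a I (lsubmx z) (rsubmx z) - opX cf cG a I (lsubmx z') (rsubmx z'))
    (opY ch cG b I (lsubmx z) (rsubmx z) - opY ch cG b I (lsubmx z') (rsubmx z')).
  by rewrite /F opp_row_mx add_row_mx.
have [] := @strongly_monotone_root R (dx + dy) F (Num.min (cf * mux + a) (ch * muy + b))
  (3 * (Lf ^+ 2 + Lh ^+ 2 + LG ^+ 2 + a ^+ 2 + b ^+ 2)) _ _ _ _ (row_mx p q).
- by rewrite lt_min m1 m2.
- rewrite mulr_gt0 // -!addrA ltr_pwDl ?exprn_gt0 //.
  by rewrite !addr_ge0 ?sqr_ge0.
- move=> z z'; rewrite Fsub /sqn !dotsplit row_mxKl row_mxKr !linearB /=.
  apply: le_trans _ (op_monotone _ _ _ _ rI).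
  by rewrite mulrDr lerD // ler_wpM2r ?sqn_ge0 // ge_min lexx ?orbT.
- move=> z z'; rewrite Fsub /sqn !dotsplit !row_mxKl !row_mxKr !linearB /=.
  exact: op_lipschitz.
move=> z /eq_row_mx[e1 e2]; by exists (lsubmx z), (rsubmx z).
Qed.

End Operators.

(** * Relative-accuracy solvers *)

Section CatalystParameters.
Variables (R : realType).

(** Bernoulli's inequality applied to the inverse, 1 + 1/(k - 1). *)
Lemma contraction_pow (k M : nat) : (0 < k)%N -> (1 - (k%:R : R)^-1) ^+ (k * M) <= (2 ^+ M)^-1.
Proof.
move=> k0; rewrite exprM -exprVn lerXn2r ?nnegrE ?invr_ge0 //.
  by rewrite exprn_ge0 // subr_ge0 invf_le1 ?ltr0n // ler1n.
case: k k0 => // -[|k] _; first by rewrite invr1 subrr expr1 invr_ge0.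
have -> : 1 - (k.+2%:R : R)^-1 = (1 + k.+1%:R^-1)^-1.
  rewrite -(natr1 k.+1); have : 0 < k.+1%:R :> R by rewrite ltr0n.
  by move: k.+1%:R => c c0; field; rewrite ?gt_eqF // addr_gt0 // addr_gt0.
rewrite exprVn lef_pV2 ?posrE ?exprn_gt0 ?addr_gt0 ?invr_gt0 //.
have bern (n : nat) (c : R) : 0 <= c -> 1 + n%:R * c <= (1 + c) ^+ n.
  move=> c0; elim: n => [|n IH]; first by rewrite mul0r addr0.
  rewrite exprS; apply: le_trans (ler_wpM2l _ IH); last by rewrite addr_ge0.
  have : 0 <= n%:R * c * c by rewrite !mulr_ge0.
  by rewrite -natr1; lra.
rewrite exprS; apply: le_trans (ler_wpM2l _ (bern _ _ _)); rewrite ?addr_ge0 ?invr_ge0 //.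
by rewrite mulfV ?pnatr_eq0 // -[X in _ <= _ * X]/(2) ler_peMl // lerDl invr_ge0.
Qed.

(** Parameters of the loop: alpha = 1/(t + 1), kap = 4^l, and 12 + 6 l inner halvings, which meet
    the accuracy required by [computes_catalyst]. *)
Lemma catalyst_accuracy (t l : nat) : (t.+1 <= 2 ^ l)%N ->
  (2^-1) ^+ (12 + 6 * l) * 2048 * (1 + 4 ^+ l) <= (t.+1%:R^-1) ^+ 4 :> R.
Proof.
move=> tl.
have l1 : 1 <= 4 ^+ l :> R by rewrite exprn_ege1 // ler1n.
apply: (@le_trans _ _ ((2^-1) ^+ (12 + 6 * l) * (4096 * 4 ^+ l))).
  by rewrite -mulrA ler_wpM2l ?exprn_ge0 ?invr_ge0 //; lra.
have -> : (2^-1) ^+ (12 + 6 * l) * (4096 * 4 ^+ l) = ((2 ^+ l)^-1) ^+ 4 :> R.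
  have p2 : 2 ^+ l != 0 :> R by rewrite expf_neq0.
  have p12 : 2 ^+ 12 != 0 :> R by rewrite expf_neq0.
  have -> : (2^-1 : R) ^+ (12 + 6 * l) = (2 ^+ 12)^-1 * (2 ^+ l)^-1 ^+ 6.
    by rewrite exprD (mulnC 6%N) exprM !exprVn.
  have -> : (4 : R) ^+ l = (2 ^+ l) ^+ 2 by rewrite exprAC; congr (_ ^+ _); ring.
  have -> : (4096 : R) = 2 ^+ 12 by ring.
  move: (2 ^+ 12) (2 ^+ l) p12 p2 => u v u0 v0.
  by field; rewrite u0 v0.
rewrite lerXn2r ?nnegrE ?invr_ge0 ?exprn_ge0 //.
by rewrite lef_pV2 ?posrE ?exprn_gt0 // -natrX ler_nat.
Qed.

(** The number of steps gives a decay 2^-(4 + 4 l), which beats the conversion factor between energy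
    and distance. *)
Lemma catalyst_rate (t l : nat) : (t.+1 <= 2 ^ l)%N ->
  4 * (1 + 4 ^+ l) / (t.+1%:R^-1) ^+ 2 *
    (1 - t.+1%:R^-1 / 2) ^+ (2 * t.+1 * (4 + 4 * l)) <= 2^-1 :> R.
Proof.
move=> tl.
have l1 : 1 <= 4 ^+ l :> R by rewrite exprn_ege1 // ler1n.
have -> : t.+1%:R^-1 / 2 = (2 * t.+1)%:R^-1 :> R by rewrite natrM invfM mulrC.
have := @contraction_pow (2 * t.+1) (4 + 4 * l) isT; move: (_ ^+ (2 * _ * _)) => c hc.
have t2 : t.+1%:R ^+ 2 <= 4 ^+ l :> R.
  have -> : (4 : R) ^+ l = (2 ^+ l) ^+ 2 by rewrite exprAC; congr (_ ^+ _); ring.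
  by rewrite lerXn2r ?nnegrE // -natrX ler_nat.
rewrite exprVn invrK.
have h0 : 0 <= 4 * (1 + 4 ^+ l) * t.+1%:R ^+ 2 :> R.
  by rewrite mulr_ge0 ?sqr_ge0 // mulr_ge0 //; lra.
apply: le_trans (ler_wpM2l h0 hc) _.
have e : (2 : R) ^+ (4 + 4 * l) = 16 * (4 ^+ l * 4 ^+ l).
  have e4 : (2 : R) ^+ 4 = 16 by ring.
  by rewrite exprD exprM e4 -exprMn (_ : 4 * 4 = 16 :> R) //; ring.
rewrite ler_pdivrMr ?exprn_gt0 // e.
set v := 4 ^+ l in l1 t2 h0 *.
have : 4 * (1 + v) * t.+1%:R ^+ 2 <= 4 * (2 * v) * v.
  apply: ler_pM => //; last by rewrite ler_wpM2l //; lra.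
  by rewrite mulr_ge0 //; lra.
by lra.
Qed.

Lemma catalyst_calls (t l : nat) : (0 < t)%N -> (t.+1 <= 2 ^ l)%N ->
  ((2 * t.+1 * (4 + 4 * l)).+1 * (12 + 6 * l) <= 600 * l ^ 2 * t)%N.
Proof.
move=> t0 tl; have l0 : (0 < l)%N by case: l tl t0 => //; case: t.
have h : ((2 * t.+1 * (4 + 4 * l)).+1 <= 33 * l * t)%N by nia.
apply: (@leq_trans (33 * l * t * (18 * l))); first by apply: leq_mul => //; lia.
by rewrite expnS expn1; nia.
Qed.

End CatalystParameters.

Section Solvers.
Variables (R : realType) (dx dy : nat).
Notation X := 'rV[R]_dx.
Notation Y := 'rV[R]_dy.
Variables (Lf LG Lh mux muy : R).
Hypothesis (Lf_gt0 : 0 < Lf).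
Hypotheses (mux_gt0 : 0 < mux) (muy_gt0 : 0 < muy).
Notation regular := (@regular R dx dy Lf LG Lh mux muy).
Notation runs I := (computes (gf I) (gh I) (gx I) (gy I)).

(* A routine dividing the squared distance to the saddle point by r^-1.  The  *)
(* relative accuracy makes the number of calls independent of the instance.   *)
Definition solvable (cf ch cG a b r : R) (nf nh ng : nat) : Prop :=
  exists s : X -> Y -> X -> Y -> routine X Y (X * Y),
  forall I, regular I -> forall p q x y xs ys,
    opX cf cG a I xs ys = p -> opY ch cG b I xs ys = q ->
    runs I (s p q x y)
      (fun o => sqn (o.1 - xs) + sqn (o.2 - ys) <= r * (sqn (x - xs) + sqn (y - ys)))
      nf nh ng.

Lemma solvable_weaken cf ch cG a b r r' nf nh ng nf' nh' ng' :
  r <= r' -> (nf <= nf')%N -> (nh <= nh')%N -> (ng <= ng')%N ->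
  solvable cf ch cG a b r nf nh ng -> solvable cf ch cG a b r' nf' nh' ng'.
Proof.
move=> rr hf hh hg [s hs]; exists s => I rI p q x y xs ys e1 e2.
apply: computes_weaken (hs I rI p q x y xs ys e1 e2) => // o /le_trans; apply.
by rewrite ler_wpM2r // addr_ge0 ?sqn_ge0.
Qed.

Lemma solvable_iter n cf ch cG a b r nf nh ng : 0 <= r ->
  solvable cf ch cG a b r nf nh ng ->
  solvable cf ch cG a b (r ^+ n) (n * nf) (n * nh) (n * ng).
Proof.
move=> r0 [s hs].
exists (fun p q x y => iterate n (fun o => s p q o.1 o.2) (x, y)).
move=> I rI p q x y xs ys e1 e2.
apply: (computes_iterate (I := fun i o => sqn (o.1 - xs) + sqn (o.2 - ys) <=
  r ^+ i * (sqn (x - xs) + sqn (y - ys)))); last by rewrite expr0 mul1r.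
move=> i [x1 y1] /= h; apply: computes_weaken (hs I rI p q x1 y1 xs ys e1 e2) => // o.
by move=> /le_trans; apply; rewrite exprS -mulrA ler_wpM2l.
Qed.

Lemma solvable_base a b r : 0 < a -> 0 < b -> 0 <= r -> solvable 0 0 0 a b r 0 0 0.
Proof.
move=> a0 b0 r0; exists (fun p q x y => ret (a^-1 *: p, b^-1 *: q)).
move=> I rI p q x y xs ys <- <-; apply: computes_ret => /=.
rewrite /opX /opY !scale0r subrr !add0r !scalerA !mulVf ?gt_eqF // !scale1r !subrr !sqn0.
by rewrite addr0 mulr_ge0 // addr_ge0 ?sqn_ge0.
Qed.

(* The block not concerned by a solver is started at its exact value.         *)
Lemma solvable_split cf ch a a' b b' r nf nh :
  0 < a' -> 0 < b' ->
  solvable cf 0 0 a b' r nf 0 0 -> solvable 0 ch 0 a' b r 0 nh 0 ->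
  solvable cf ch 0 a b r nf nh 0.
Proof.
move=> a0 b0 [s hs] [s' hs'].
exists (fun p q x y => bind (s p 0 x 0) (fun o => bind (s' 0 q 0 y) (fun o' => ret (o.1, o'.2)))).
move=> I rI p q x y xs ys ep eq.
have ep' : opX cf 0 a I xs 0 = p by rewrite -ep /opX !scale0r.
have eq' : opY ch 0 b I 0 ys = q by rewrite -eq /opY !scale0r.
have ex : opX 0 0 a' I 0 ys = 0 by rewrite /opX !scale0r scaler0 !addr0.
have ey : opY 0 0 b' I xs 0 = 0 by rewrite /opY !scale0r subr0 scaler0 !addr0.
have h1 := hs I rI p 0 x 0 xs 0 ep' ey; have h2 := hs' I rI 0 q 0 y 0 ys ex eq'.
rewrite -[nf]addn0 -[X in computes _ _ _ _ _ _ _ X _]addn0 -[X in computes _ _ _ _ _ _ _ _ X]addn0.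
rewrite -[X in computes _ _ _ _ _ _ _ (X + _) _]add0n -addnA.
apply: computes_bind h1 _ => o /= h1.
rewrite -[X in computes _ _ _ _ _ _ X]addn0 -[X in computes _ _ _ _ _ _ _ _ X]addn0.
apply: computes_bind h2 _ => o' /= h2; apply: computes_ret => /=.
have n1 := sqn_ge0 (o.2 - 0); have n2 := sqn_ge0 (o'.1 - 0).
rewrite subrr sqn0 in h1; rewrite subrr sqn0 in h2; lra.
Qed.

(** Here (u, v) and (c, d) are the errors before and after the step, (u1, v1) the forward increment.
    The last hypothesis gives 4 L |c|^2 <= (3 L u - u1, c) summed over the blocks, hence 16 L^2
    |c|^2 <= |3 L u - u1|^2; monotonicity drops the cross term, leaving 10 L^2 |u|^2. *)
Lemma forward_backward_contraction (L : R) (u c u1 : X) (v d v1 : Y) :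
  0 < L -> 0 <= dot u1 u + dot v1 v ->
  sqn u1 + sqn v1 <= L ^+ 2 * (sqn u + sqn v) ->
  L * (sqn c + sqn d) <=
    dot (3 * L *: (u - c) - u1) c + dot (3 * L *: (v - d) - v1) d ->
  sqn c + sqn d <= 5 / 8 * (sqn u + sqn v).
Proof.
move=> L0 mono lip h.
have h1 := ler_wpM2l (ltW L0) h; have h2 := ler_wpM2l (ltW L0) mono.
have h3 := sqn_ge0 (4 * L *: c - (3 * L *: u - u1)).
have h4 := sqn_ge0 (4 * L *: d - (3 * L *: v - v1)).
suff : L ^+ 2 * (sqn c + sqn d) <= L ^+ 2 * (5 / 8 * (sqn u + sqn v)).
  by rewrite ler_pM2l // exprn_gt0.
move: lip h1 h2 h3 h4; dot_expand => lip h1 h2 h3 h4; lra.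
Qed.

(** Eight inner halvings degrade the contraction factor from 5/8 to at most 7/8, and (7/8)^6 <= 1/2,
    whence six outer rounds. *)
Lemma solvable_forward cf ch cG df dh dG a b L nf nh ng nf' nh' ng'
    (fw : X -> Y -> routine X Y (X * Y)) :
  0 <= cf <= 1 -> 0 <= ch <= 1 -> 0 <= cG <= 1 ->
  0 <= df <= 1 -> 0 <= dh <= 1 -> 0 <= dG <= 1 ->
  0 < L -> L <= a -> L <= b ->
  (forall I x y, regular I ->
    runs I (fw x y) (fun g => g = (opX df dG 0 I x y, opY dh dG 0 I x y)) nf' nh' ng') ->
  (forall I x y x' y', regular I ->
    sqn (opX df dG 0 I x y - opX df dG 0 I x' y') +
    sqn (opY dh dG 0 I x y - opY dh dG 0 I x' y')
    <= L ^+ 2 * (sqn (x - x') + sqn (y - y'))) ->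
  solvable cf ch cG (a + 3 * L) (b + 3 * L) 2^-1 nf nh ng ->
  solvable (cf + df) (ch + dh) (cG + dG) a b 2^-1
    (6 * (nf' + 8 * nf)) (6 * (nh' + 8 * nh)) (6 * (ng' + 8 * ng)).
Proof.
move=> cf01 ch01 cG01 df01 dh01 dG01 L0 La Lb hfw lip /(solvable_iter (8)).
rewrite invr_ge0 ler0n => /(_ isT) [s hs].
suff : solvable (cf + df) (ch + dh) (cG + dG) a b (7 / 8) (nf' + 8 * nf) (nh' + 8 * nh) (ng' + 8 * ng).
  move=> /(solvable_iter (6)); rewrite divr_ge0 // => /(_ isT).
  by apply: solvable_weaken => //; lra.
exists (fun p q x y => bind (fw x y) (fun g =>
  s (p - g.1 + (3 * L) *: x) (q - g.2 + (3 * L) *: y) x y)).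
move=> I rI p q x y xs ys ep eq.
apply: computes_bind (hfw I x y rI) _ => _ ->; cbn [fst snd].
set p' := p - _ + _; set q' := q - _ + _.
have [/andP[cf0 _] /andP[ch0 _]] := (cf01, ch01).
have ma : 0 < cf * mux + (a + 3 * L) by have := mulr_ge0 cf0 (ltW mux_gt0); lra.
have mb : 0 < ch * muy + (b + 3 * L) by have := mulr_ge0 ch0 (ltW muy_gt0); lra.
have [w1 [w2 [e1 e2]]] := op_root Lf_gt0 cf01 ch01 cG01 p' q' rI ma mb.
have mono := op_monotone 0 0 df01 dh01 dG01 x y xs ys rI.
have mono0 : 0 <= dot (opX df dG 0 I x y - opX df dG 0 I xs ys) (x - xs) +
  dot (opY dh dG 0 I x y - opY dh dG 0 I xs ys) (y - ys).
  have [/andP[df0 _] /andP[dh0 _]] := (df01, dh01).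
  by apply: le_trans _ mono; rewrite !addr0 addr_ge0 ?mulr_ge0 ?sqn_ge0 // ltW.
have back := op_monotone a b cf01 ch01 cG01 w1 w2 xs ys rI.
have w5 : sqn (w1 - xs) + sqn (w2 - ys) <= 5 / 8 * (sqn (x - xs) + sqn (y - ys)).
  apply: (forward_backward_contraction L0 mono0 (lip _ _ _ _ _ rI)).
  have -> : 3 * L *: (x - xs - (w1 - xs)) - (opX df dG 0 I x y - opX df dG 0 I xs ys)
    = opX cf cG a I w1 w2 - opX cf cG a I xs ys.
    have -> : opX cf cG a I w1 w2 = p' - (3 * L) *: w1.
      by rewrite -e1 /opX; apply/rowP => i; rewrite !mxE; ring.
    by rewrite /p' -ep /opX; apply/rowP => i; rewrite !mxE; ring.
  have -> : 3 * L *: (y - ys - (w2 - ys)) - (opY dh dG 0 I x y - opY dh dG 0 I xs ys)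
    = opY ch cG b I w1 w2 - opY ch cG b I xs ys.
    have -> : opY ch cG b I w1 w2 = q' - (3 * L) *: w2.
      by rewrite -e2 /opY; apply/rowP => i; rewrite !mxE; ring.
    by rewrite /q' -eq /opY; apply/rowP => i; rewrite !mxE; ring.
  apply: le_trans _ back; rewrite mulrDr lerD // ler_wpM2r ?sqn_ge0 //.
    by rewrite -[L]add0r lerD // mulr_ge0 // ltW.
  by rewrite -[L]add0r lerD // mulr_ge0 // ltW.
apply: computes_weaken (hs I rI p' q' x y w1 w2 e1 e2) => // o ho.
(* Young with 1/5: 6/5 times 5/8, plus 6 times an inner error of at most (13/4) / 256, is below
   7/8. *)
have i5 : (0 : R) < 5^-1 by rewrite invr_gt0.
have := sqnD_le (w1 - xs) (o.1 - w1) i5; have := sqnD_le (w2 - ys) (o.2 - w2) i5.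
rewrite (addrC (w1 - xs)) (addrC (w2 - ys)) !subrKA.
have := sqn_triangle x xs w1; have := sqn_triangle y ys w2.
rewrite (sqnBC xs w1) (sqnBC ys w2) invrK => t1 t2 t3 t4.
have {}ho : 256 * (sqn (o.1 - w1) + sqn (o.2 - w2)) <= sqn (x - w1) + sqn (y - w2).
  have := ler_wpM2l (exprn_ge0 8 (ler0n R 2)) ho.
  rewrite [X in _ <= X -> _]mulrA -exprMn mulfV ?pnatr_eq0 // expr1n mul1r.
  by rewrite (_ : 2 ^+ 8 = 256 :> R) //; ring.
have := sqn_ge0 (x - xs); have := sqn_ge0 (y - ys); lra.
Qed.

(** The loop is applied to K = - value, minimized in y, with x as the warm-started block. The
    proximal center enters only through the linear term q + lam z, so one inner solver serves all
    subproblems. *)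
Lemma solvable_catY cf ch cG a b lam mu t l nf nh ng :
  0 <= cf <= 1 -> 0 <= ch <= 1 -> 0 <= cG <= 1 -> 0 < lam -> 0 < mu ->
  mu <= ch * muy + b -> lam <= t%:R ^+ 2 * mu -> (0 < t)%N -> (t.+1 <= 2 ^ l)%N ->
  0 < cf * mux + a -> LG ^+ 2 <= 4 ^+ l * (cf * mux + a) ^+ 2 ->
  solvable cf ch cG a (b + lam) 2^-1 nf nh ng ->
  solvable cf ch cG a b 2^-1 (600 * l ^ 2 * t * nf) (600 * l ^ 2 * t * nh) (600 * l ^ 2 * t * ng).
Proof.
move=> cf01 ch01 cG01 l0 mu0 hmu hlam t0 tl ma hkap /(solvable_iter (12 + 6 * l)).
rewrite invr_ge0 ler0n => /(_ isT) [s hs].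
have mb : 0 < ch * muy + b by apply: lt_le_trans hmu.
have al0 : 0 < t.+1%:R^-1 :> R by rewrite invr_gt0.
have al2 : t.+1%:R^-1 * 2 <= 1 :> R.
  by rewrite mulrC ler_pdivrMr // mul1r ler_nat.
have alm : t.+1%:R^-1 ^+ 2 * lam <= ch * muy + b.
  apply: le_trans _ hmu; rewrite exprVn mulrC ler_pdivrMr ?exprn_gt0 // mulrC.
  apply: le_trans hlam _; apply: ler_wpM2r; first exact: ltW.
  by rewrite lerXn2r ?nnegrE // ler_nat.
exists (fun p q x y => catalyst (fun w z => s p (q + lam *: z) w z) (t.+1%:R^-1)
  (2 * t.+1 * (4 + 4 * l)) x y).
move=> I rI p q x y xs ys ep eq.
pose P (z : Y) (w : X) (u : Y) := opX cf cG a I w u = p /\ opY ch cG (b + lam) I w u = q + lam *: z.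
pose K w u := - value cf ch cG a b p q I w u.
have PP z w u : P z w u -> prox_saddle K P lam t.+1%:R^-1 z w u.
  move=> Pz; have [e1 e2] := Pz; split=> // [w'|u'].
    rewrite /K lerN2; have := value_convex ch a b cf01 cG01 p q w w' u rI.
    rewrite e1 subrr dot0l addr0; apply: le_trans.
    by rewrite lerDl mulr_ge0 ?sqn_ge0 // divr_ge0 // ltW.
  rewrite /K; have := value_concave cf a b ch01 cG01 p q w u u' rI.
  have -> : opY ch cG b I w u - q = lam *: (z - u).
    have -> : opY ch cG b I w u = opY ch cG (b + lam) I w u - lam *: u.
      by rewrite /opY; apply/rowP => i; rewrite !mxE; ring.
    by rewrite e2; apply/rowP => i; rewrite !mxE; ring.
  rewrite dotZl; have := ler_wpM2r (sqn_ge0 (u' - u)) alm.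
  by move: (t.+1%:R^-1) => al h1 h2; lra.
have sol : prox_saddle K P lam t.+1%:R^-1 ys xs ys.
  by apply: PP; split=> //; rewrite -eq /opY; apply/rowP => i; rewrite !mxE; ring.
have mb' : 0 < ch * muy + (b + lam) by rewrite addrA addr_gt0.
have := @computes_catalyst R X Y dx dy (gf I) (gh I) (gx I) (gy I)
  (fun w z => s p (q + lam *: z) w z) t.+1%:R^-1 lam (4 ^+ l) (2^-1 ^+ (12 + 6 * l))
  K P xs ys _ _ _ (2 * t.+1 * (4 + 4 * l)) x y l0 al0 al2 _ sol.
move=> /(_ ((12 + 6 * l) * nf)%N ((12 + 6 * l) * nh)%N ((12 + 6 * l) * ng)%N).
case=> //.
- move=> z w u z' w' u' [[e1 e2] _ _] [[e1' e2'] _ _].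
  rewrite -(ler_pM2l (exprn_gt0 2 ma)).
  apply: le_trans (sensitivityX b cf01 ch01 cG01 rI ma e1 e1') _.
  by rewrite mulrA ler_wpM2r ?sqn_ge0 // mulrC.
- move=> z.
  have [w [u [e1 e2]]] := op_root Lf_gt0 cf01 ch01 cG01 p (q + lam *: z) rI ma mb'.
  by exists w, u; apply: PP.
- exact: catalyst_accuracy.
- by move=> w z W U [[e1 e2] _ _]; apply: hs.
move=> o [a1 [b1 [c1 [d1 [h1 h2 h3 h4 h5]]]]].
exists o, a1, b1, c1, d1; split=> //.
- apply: le_trans h1 _; rewrite ler_wpM2r ?addr_ge0 ?sqn_ge0 //.
  exact: catalyst_rate.
- by apply: leq_trans h2 _; rewrite mulnA leq_mul2r catalyst_calls ?orbT.
- by apply: leq_trans h3 _; rewrite mulnA leq_mul2r catalyst_calls ?orbT.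
- by apply: leq_trans h4 _; rewrite mulnA leq_mul2r catalyst_calls ?orbT.
Qed.

(** Same loop with K = value and the blocks exchanged, whence the swaps of pairs. *)
Lemma solvable_catX cf ch cG a b lam mu t l nf nh ng :
  0 <= cf <= 1 -> 0 <= ch <= 1 -> 0 <= cG <= 1 -> 0 < lam -> 0 < mu ->
  mu <= cf * mux + a -> lam <= t%:R ^+ 2 * mu -> (0 < t)%N -> (t.+1 <= 2 ^ l)%N ->
  0 < ch * muy + b -> LG ^+ 2 <= 4 ^+ l * (ch * muy + b) ^+ 2 ->
  solvable cf ch cG (a + lam) b 2^-1 nf nh ng ->
  solvable cf ch cG a b 2^-1 (600 * l ^ 2 * t * nf) (600 * l ^ 2 * t * nh) (600 * l ^ 2 * t * ng).
Proof.
move=> cf01 ch01 cG01 l0 mu0 hmu hlam t0 tl mb hkap /(solvable_iter (12 + 6 * l)).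
rewrite invr_ge0 ler0n => /(_ isT) [s hs].
have ma : 0 < cf * mux + a by apply: lt_le_trans hmu.
have al0 : 0 < t.+1%:R^-1 :> R by rewrite invr_gt0.
have al2 : t.+1%:R^-1 * 2 <= 1 :> R.
  by rewrite mulrC ler_pdivrMr // mul1r ler_nat.
have alm : t.+1%:R^-1 ^+ 2 * lam <= cf * mux + a.
  apply: le_trans _ hmu; rewrite exprVn mulrC ler_pdivrMr ?exprn_gt0 // mulrC.
  apply: le_trans hlam _; apply: ler_wpM2r; first exact: ltW.
  by rewrite lerXn2r ?nnegrE // ler_nat.
pose inner p q w z := bind (s (p + lam *: z) q z w) (fun o => @ret X Y (Y * X) (o.2, o.1)).
exists (fun p q x y => bind (catalyst (inner p q) (t.+1%:R^-1)
  (2 * t.+1 * (4 + 4 * l)) y x) (fun o => ret (o.2, o.1))).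
move=> I rI p q x y xs ys ep eq.
pose P (z : X) (w : Y) (u : X) := opX cf cG (a + lam) I u w = p + lam *: z /\ opY ch cG b I u w = q.
pose K w u := value cf ch cG a b p q I u w.
have PP z w u : P z w u -> prox_saddle K P lam t.+1%:R^-1 z w u.
  move=> Pz; have [e1 e2] := Pz; split=> // [w'|u'].
    rewrite /K; have := value_concave cf a b ch01 cG01 p q u w w' rI.
    rewrite e2 subrr dot0l subr0 => /le_trans; apply.
    by rewrite gerBl mulr_ge0 ?sqn_ge0 // divr_ge0 // ltW.
  rewrite /K; have := value_convex ch a b cf01 cG01 p q u u' w rI.
  have -> : opX cf cG a I u w - p = lam *: (z - u).
    have -> : opX cf cG a I u w = opX cf cG (a + lam) I u w - lam *: u.
      by rewrite /opX; apply/rowP => i; rewrite !mxE; ring.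
    by rewrite e1; apply/rowP => i; rewrite !mxE; ring.
  rewrite dotZl; have := ler_wpM2r (sqn_ge0 (u' - u)) alm.
  by move: (t.+1%:R^-1) => al h1 h2; lra.
have sol : prox_saddle K P lam t.+1%:R^-1 xs ys xs.
  by apply: PP; split=> //; rewrite -ep /opX; apply/rowP => i; rewrite !mxE; ring.
have ma' : 0 < cf * mux + (a + lam) by rewrite addrA addr_gt0.
have := @computes_catalyst R X Y dy dx (gf I) (gh I) (gx I) (gy I)
  (inner p q) t.+1%:R^-1 lam (4 ^+ l) (2^-1 ^+ (12 + 6 * l))
  K P ys xs _ _ _ (2 * t.+1 * (4 + 4 * l)) y x l0 al0 al2 _ sol.
move=> /(_ ((12 + 6 * l) * nf)%N ((12 + 6 * l) * nh)%N ((12 + 6 * l) * ng)%N) cat.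
have {}cat : computes (gf I) (gh I) (gx I) (gy I) (catalyst (inner p q) t.+1%:R^-1
    (2 * t.+1 * (4 + 4 * l)) y x) (fun o => sqn (o.1 - ys) + sqn (o.2 - xs) <=
      2^-1 * (sqn (x - xs) + sqn (y - ys)))
    (600 * l ^ 2 * t * nf) (600 * l ^ 2 * t * nh) (600 * l ^ 2 * t * ng).
  apply: computes_weaken (cat _ _ _ _ _ _); last 1 first.
  - move=> w z W U [[e1 e2] _ _]; rewrite -[X in computes _ _ _ _ _ _ X]addn0.
    rewrite -[X in computes _ _ _ _ _ _ _ X]addn0 -[X in computes _ _ _ _ _ _ _ _ X]addn0.
    apply: computes_bind (hs I rI _ _ _ _ _ _ e1 e2) _ => o /= h.
    by apply: computes_ret => /=; rewrite addrC (addrC (sqn (w - W))).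
  - move=> o /le_trans; apply; rewrite (addrC (sqn (x - xs))).
    by rewrite ler_wpM2r ?addr_ge0 ?sqn_ge0 // catalyst_rate.
  - by rewrite mulnA leq_mul2r catalyst_calls ?orbT.
  - by rewrite mulnA leq_mul2r catalyst_calls ?orbT.
  - by rewrite mulnA leq_mul2r catalyst_calls ?orbT.
  - by rewrite exprn_ge0.
  - move=> z w u z' w' u' [[e1 e2] _ _] [[e1' e2'] _ _].
    rewrite -(ler_pM2l (exprn_gt0 2 mb)).
    apply: le_trans (sensitivityY a cf01 ch01 cG01 rI mb e2 e2') _.
    by rewrite mulrA ler_wpM2r ?sqn_ge0 // mulrC.
  - move=> z.
    have [u [w [e1 e2]]] := op_root Lf_gt0 cf01 ch01 cG01 (p + lam *: z) q rI ma' mb.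
    by exists w, u; apply: PP.
  - by rewrite exprn_ge0 ?invr_ge0.
  - exact: catalyst_accuracy.
rewrite -[X in computes _ _ _ _ _ _ X]addn0 -[X in computes _ _ _ _ _ _ _ X]addn0.
rewrite -[X in computes _ _ _ _ _ _ _ _ X]addn0.
apply: computes_bind cat _ => o h; apply: computes_ret => /=.
by rewrite addrC.
Qed.

End Solvers.

(** * Nesting the solvers *)

Section NestedSolvers.
Variables (R : realType) (dx dy : nat).
Notation X := 'rV[R]_dx.
Notation Y := 'rV[R]_dy.
Variables (Lf LG Lh mux muy : R).
Hypotheses (Lf_gt0 : 0 < Lf) (LG_gt0 : 0 < LG) (Lh_gt0 : 0 < Lh).
Hypotheses (mux_gt0 : 0 < mux) (muy_gt0 : 0 < muy).
Notation solvable := (@solvable R dx dy Lf LG Lh mux muy).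

Let le01 : 0 <= (0 : R) <= 1. Proof. by rewrite lexx ler01. Qed.
Let le11 : 0 <= (1 : R) <= 1. Proof. by rewrite lexx ler01. Qed.

Lemma solvable_forward_f ch cG a b nf nh ng : 0 <= ch <= 1 -> 0 <= cG <= 1 ->
  Lf <= a -> Lf <= b ->
  solvable 0 ch cG (a + 3 * Lf) (b + 3 * Lf) 2^-1 nf nh ng ->
  solvable 1 ch cG a b 2^-1 (6 * (1 + 8 * nf)) (6 * (0 + 8 * nh)) (6 * (0 + 8 * ng)).
Proof.
move=> h1 h2 ha hb hs.
have -> : solvable 1 ch cG = solvable (0 + 1) (ch + 0) (cG + 0) by rewrite add0r !addr0.
apply: (solvable_forward (fw := fun x y => bind (fun k => Query_f x k) (fun g => ret (g, 0)))
  Lf_gt0 mux_gt0 muy_gt0 le01 h1 h2 le11 le01 le01 Lf_gt0) => //.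
- move=> I x y rI; rewrite -[X in computes _ _ _ _ _ _ X]addn0.
  apply: (computes_bind (nh := 0) (nh' := 0) (ng := 0) (ng' := 0) (computes_f _ _ _ _ x)) => _ ->.
  by apply: computes_ret; rewrite /opX /opY !scale0r scale1r subr0 !addr0.
- move=> I x y x' y' rI; rewrite /opX /opY !scale0r !scale1r !subr0 !addr0 subrr sqn0 addr0.
  apply: le_trans (f_smooth rI x x') _.
  by rewrite ler_wpM2l ?sqr_ge0 // lerDl sqn_ge0.
Qed.

Lemma solvable_forward_h L cf cG a b nf nh ng : 0 <= cf <= 1 -> 0 <= cG <= 1 ->
  Lh <= L -> L <= a -> L <= b ->
  solvable cf 0 cG (a + 3 * L) (b + 3 * L) 2^-1 nf nh ng ->
  solvable cf 1 cG a b 2^-1 (6 * (0 + 8 * nf)) (6 * (1 + 8 * nh)) (6 * (0 + 8 * ng)).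
Proof.
move=> h1 h2 hL ha hb hs; have L0 := lt_le_trans Lh_gt0 hL.
have -> : solvable cf 1 cG = solvable (cf + 0) (0 + 1) (cG + 0) by rewrite add0r !addr0.
apply: (solvable_forward (fw := fun x y => bind (fun k => Query_h y k) (fun g => ret (0, g)))
  Lf_gt0 mux_gt0 muy_gt0 h1 le01 h2 le01 le11 le01 L0) => //.
- move=> I x y rI; rewrite -[X in computes _ _ _ _ _ _ _ X]addn0.
  apply: (computes_bind (nf := 0) (nf' := 0) (ng := 0) (ng' := 0) (computes_h _ _ _ _ y)) => _ ->.
  by apply: computes_ret; rewrite /opX /opY !scale0r scale1r subr0 !addr0.
- move=> I x y x' y' rI; rewrite /opX /opY !scale0r !scale1r !subr0 !addr0 subrr sqn0 add0r.
  apply: le_trans (h_smooth rI y y') _; apply: ler_pM; rewrite ?sqr_ge0 ?sqn_ge0 //.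
    by rewrite lerXn2r ?nnegrE ?(ltW Lh_gt0) ?(ltW L0).
  by rewrite lerDr sqn_ge0.
Qed.

Lemma solvable_forward_G cf ch a b nf nh ng : 0 <= cf <= 1 -> 0 <= ch <= 1 ->
  LG <= a -> LG <= b ->
  solvable cf ch 0 (a + 3 * LG) (b + 3 * LG) 2^-1 nf nh ng ->
  solvable cf ch 1 a b 2^-1 (6 * (0 + 8 * nf)) (6 * (0 + 8 * nh)) (6 * (1 + 8 * ng)).
Proof.
move=> h1 h2 ha hb hs.
have -> : solvable cf ch 1 = solvable (cf + 0) (ch + 0) (0 + 1) by rewrite add0r !addr0.
apply: (solvable_forward (fw := fun x y => bind
   (fun k => Query_Gx x y (fun u => Query_Gy x y (fun v => k (u, v))))
   (fun g => ret (g.1, - g.2)))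
  Lf_gt0 mux_gt0 muy_gt0 h1 h2 le01 le01 le01 le11 LG_gt0) => //.
- move=> I x y rI; rewrite -[X in computes _ _ _ _ _ _ _ _ X]addn0.
  apply: (computes_bind (nf := 0) (nf' := 0) (nh := 0) (nh' := 0) (computes_G _ _ _ _ x y)) => _ ->.
  by apply: computes_ret; rewrite /opX /opY !scale0r !scale1r !add0r !addr0.
- move=> I x y x' y' rI; rewrite /opX /opY !scale0r !scale1r !add0r !addr0.
  rewrite -[in X in _ + X]opprD sqnN.
  by apply: le_trans (G_smooth rI x y x' y').
Qed.

Let moduli_sharp : [/\ 0 < 1 * muy + (0 + LG), LG <= 1 * muy + (0 + LG), LG <= 0 + LG,
  LG <= 0 + LG + 3 * LG & 0 <= 1 * muy + (0 + LG)].
Proof. by have G0 := LG_gt0; have y0 := muy_gt0; split; lra. Qed.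

Let moduli_flat : Lf <= LG -> [/\ 0 < 1 * muy + (0 + LG + 3 * Lf),
  LG <= 1 * muy + (0 + LG + 3 * Lf), Lf <= 0 + Lf & Lf <= 0 + LG] /\
  [/\ Lf <= 0 * mux + (0 + Lf + 3 * Lf), LG <= 0 + Lf + 3 * Lf + LG, LG <= 0 + LG + 3 * Lf,
  LG <= 0 + LG + 3 * Lf + 3 * LG & 0 < 0 + Lf + 3 * Lf + LG + 3 * LG].
Proof.
by move=> h; have f0 := Lf_gt0; have G0 := LG_gt0; have y0 := muy_gt0; do !split; lra.
Qed.

Variable l : nat.

(** Accelerated gradient descent for the proximal step of f: a loop in x around forward steps on f.
    The y block is a dummy, whose regularization [Lf] satisfies the side conditions. *)
Lemma solvable_prox_f a mu t : 0 < mu -> mu <= a -> Lf <= t%:R ^+ 2 * mu -> LG <= Lf ->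
  (0 < t)%N -> (t.+1 <= 2 ^ l)%N ->
  solvable 1 0 0 a Lf 2^-1 (600 * l ^ 2 * t * 6) 0 0.
Proof.
move=> mu0 mua ht hL t0 tl.
have a0 : 0 < a := lt_le_trans mu0 mua.
have l1 : (1 : R) <= 4 ^+ l by rewrite exprn_ege1 // ler1n.
have h : solvable 0 0 0 (a + Lf + 3 * Lf) (Lf + 3 * Lf) 2^-1 0 0 0.
  by apply: solvable_base; rewrite ?invr_ge0 //; have := Lf_gt0; lra.
have {}h := solvable_forward_f le01 le01 _ _ h.
apply: solvable_weaken (solvable_catX Lf_gt0 le11 le01 le01 Lf_gt0 mu0 _ ht t0 tl _ _ (h _ _)) => //.
- by rewrite !(muln0, addn0).
- by rewrite !(muln0, addn0).
- by rewrite mul1r -[mu]add0r lerD // ltW.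
- by rewrite mul0r add0r.
- rewrite mul0r add0r -[X in X <= _]mul1r; apply: ler_pM => //; first exact: sqr_ge0.
  by rewrite lerXn2r ?nnegrE ?(ltW LG_gt0) ?(ltW Lf_gt0).
- by rewrite lerDr ltW.
Qed.

Lemma solvable_prox_h b t : LG <= b ->
  Num.max Lh LG <= t%:R ^+ 2 * LG -> (0 < t)%N -> (t.+1 <= 2 ^ l)%N ->
  solvable 0 1 0 (Num.max Lh LG) b 2^-1 0 (600 * l ^ 2 * t * 6) 0.
Proof.
set M := Num.max Lh LG => LGb ht t0 tl.
have M0 : 0 < M by rewrite lt_max Lh_gt0.
have b0 : 0 < b := lt_le_trans LG_gt0 LGb.
have l1 : (1 : R) <= 4 ^+ l by rewrite exprn_ege1 // ler1n.
have h : solvable 0 0 0 (M + 3 * M) (b + M + 3 * M) 2^-1 0 0 0.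
  by apply: solvable_base; rewrite ?invr_ge0 //; lra.
have {}h := solvable_forward_h le01 le01 _ _ _ h.
apply: solvable_weaken (solvable_catY Lf_gt0 le01 le11 le01 M0 LG_gt0 _ ht t0 tl _ _ (h _ _ _)) => //.
- by rewrite !(muln0, addn0).
- by rewrite !(muln0, addn0).
- by rewrite mul1r -[LG]add0r lerD // ltW.
- by rewrite mul0r add0r.
- rewrite mul0r add0r -[X in X <= _]mul1r; apply: ler_pM => //; first exact: sqr_ge0.
  by rewrite lerXn2r ?nnegrE ?(ltW LG_gt0) ?(ltW M0) // /M le_max lexx orbT.
- by rewrite /M le_max lexx.
- by rewrite lerDr ltW.
Qed.

(** Nesting, from outside: loop in y, loop in x, forward step on G, separate proximal steps on f and
    h. *)
Lemma solvable_saddle_sharp_f t1 t2 tf th :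
  LG <= Lf -> LG ^+ 2 <= 4 ^+ l * mux ^+ 2 ->
  LG <= t1%:R ^+ 2 * muy -> (0 < t1)%N -> (t1.+1 <= 2 ^ l)%N ->
  LG <= t2%:R ^+ 2 * mux -> (0 < t2)%N -> (t2.+1 <= 2 ^ l)%N ->
  Lf <= tf%:R ^+ 2 * LG -> (0 < tf)%N -> (tf.+1 <= 2 ^ l)%N ->
  Num.max Lh LG <= th%:R ^+ 2 * LG -> (0 < th)%N -> (th.+1 <= 2 ^ l)%N ->
  let E := (600 * l ^ 2)%N in
  solvable 1 1 1 0 0 2^-1
    (288 * E ^ 3 * (t1 * t2 * tf)) (288 * E ^ 3 * (t1 * t2 * th)) (6 * E ^ 2 * (t1 * t2)).
Proof.
move=> hL hk h1 p1 q1 h2 p2 q2 hf pf qf hh ph qh E.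
have l1 : (1 : R) <= 4 ^+ l by rewrite exprn_ege1 // ler1n.
have M0 : 0 < Num.max Lh LG by rewrite lt_max Lh_gt0.
have [m1 m2 g0] := And3 (ltW mux_gt0) (ltW muy_gt0) (ltW LG_gt0).
have [a1 a2 a3 a4 a5] := moduli_sharp.
have sf := solvable_prox_f (a := 0 + LG + 3 * LG) LG_gt0 _ hf hL pf qf.
have sh := solvable_prox_h (b := 0 + LG + 3 * LG) _ hh ph qh.
have sp := solvable_split M0 Lf_gt0 (sf _) (sh _).
have sG := solvable_forward_G le11 le11 _ _ (sp _ _).
have sX := solvable_catX Lf_gt0 le11 le11 le11 LG_gt0 mux_gt0 _ h2 p2 q2 _ _ (sG _ _ _ _).
have sY := solvable_catY Lf_gt0 le11 le11 le11 LG_gt0 muy_gt0 _ h1 p1 q1 _ _ (sX _ _ _ _ _ _ _).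
apply: solvable_weaken (sY _ _ _ _ _ _ _ _ _ _) => //; rewrite -/E.
- by move: E => e; apply: eq_leq; ring.
- by move: E => e; apply: eq_leq; ring.
- by move: E => e; apply: eq_leq; ring.
- by rewrite mul1r addr0.
- by rewrite mul1r addr0.
- by rewrite mul1r addr0.
- by rewrite mul1r addr0.
- rewrite -[X in X <= _]mul1r; apply: ler_pM => //; first exact: sqr_ge0.
  by rewrite lerXn2r ?nnegrE.
Qed.

(** Nesting, from outside: loop in y, loop in x with [Lf], forward step on f, loop in x with [LG],
    forward step on G, proximal step on h. Only the first two loops multiply the calls to f. *)
Lemma solvable_saddle_flat_f t1 t2 t3 th :
  Lf <= LG -> LG ^+ 2 <= 4 ^+ l * mux ^+ 2 ->
  LG <= t1%:R ^+ 2 * muy -> (0 < t1)%N -> (t1.+1 <= 2 ^ l)%N ->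
  Lf <= t2%:R ^+ 2 * mux -> (0 < t2)%N -> (t2.+1 <= 2 ^ l)%N ->
  LG <= t3%:R ^+ 2 * Lf -> (0 < t3)%N -> (t3.+1 <= 2 ^ l)%N ->
  Num.max Lh LG <= th%:R ^+ 2 * LG -> (0 < th)%N -> (th.+1 <= 2 ^ l)%N ->
  let E := (600 * l ^ 2)%N in
  solvable 1 1 1 0 0 2^-1 (6 * E ^ 2 * (t1 * t2))
    (48 * 288 * E ^ 4 * (t1 * t2 * t3 * th)) (288 * E ^ 3 * (t1 * t2 * t3)).
Proof.
move=> hL hk h1 p1 q1 h2 p2 q2 h3 p3 q3 hh ph qh E.
have l1 : (1 : R) <= 4 ^+ l by rewrite exprn_ege1 // ler1n.
have M0 : 0 < Num.max Lh LG by rewrite lt_max Lh_gt0.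
have [m1 m2 g0] := And3 (ltW mux_gt0) (ltW muy_gt0) (ltW LG_gt0).
have [a1 a2 a3 a4 a5] := moduli_sharp.
have [[b1 b2 b3 b4] [b5 b6 b7 b8 b9]] := moduli_flat hL.
have sh := solvable_prox_h (b := 0 + LG + 3 * Lf + 3 * LG) _ hh ph qh.
have s0 : solvable 0 0 0 (0 + Lf + 3 * Lf + LG + 3 * LG) 1 2^-1 0 0 0.
  by apply: solvable_base; rewrite ?invr_ge0.
have sp := solvable_split M0 ltr01 s0 (sh _).
have sG := solvable_forward_G le01 le11 _ _ (sp _).
have sX := solvable_catX Lf_gt0 le01 le11 le11 LG_gt0 Lf_gt0 _ h3 p3 q3 _ _ (sG _ _ _).
have sF := solvable_forward_f le11 le11 _ _ (sX _ _ _ _ _ _).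
have sX2 := solvable_catX Lf_gt0 le11 le11 le11 Lf_gt0 mux_gt0 _ h2 p2 q2 _ _ (sF _ _ _ _ _ _ _ _).
have sY := solvable_catY Lf_gt0 le11 le11 le11 LG_gt0 muy_gt0 _ h1 p1 q1 _ _
  (sX2 _ _ _ _ _ _ _ _ _ _ _).
apply: solvable_weaken (sY _ _ _ _ _ _ _ _ _ _ _ _ _ _) => //; rewrite -/E.
- by move: E => e; apply: eq_leq; ring.
- by move: E => e; apply: eq_leq; ring.
- by move: E => e; apply: eq_leq; ring.
- by rewrite mul1r addr0.
- by rewrite mul1r addr0.
- by rewrite mul1r addr0.
- by rewrite mul1r addr0.
- rewrite -[X in X <= _]mul1r; apply: ler_pM => //; first exact: sqr_ge0.
  by rewrite lerXn2r ?nnegrE.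
- rewrite -[X in X <= _]mul1r; apply: ler_pM => //; first exact: sqr_ge0.
  by rewrite lerXn2r ?nnegrE // ltW.
Qed.

End NestedSolvers.

(** * Gradients of smooth convex functions *)

Section Gradients.
Local Open Scope classical_set_scope.
Local Open Scope ring_scope.
Variable R : realType.

Lemma enormE n (x : 'rV[R]_n) : enorm x = Num.sqrt (sqn x).
Proof. by congr Num.sqrt; apply: eq_bigr => i _; rewrite expr2. Qed.

Lemma sqr_enorm n (x : 'rV[R]_n) : enorm x ^+ 2 = sqn x.
Proof. by rewrite enormE sqr_sqrtr // sqn_ge0. Qed.

Lemma sqn_row_mx m n (x : 'rV[R]_m) (y : 'rV[R]_n) : sqn (row_mx x y) = sqn x + sqn y.
Proof.
rewrite /sqn /dot big_split_ord /=; congr (_ + _); apply: eq_bigr => i _.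
  by rewrite !row_mxEl.
by rewrite !row_mxEr.
Qed.

Lemma L_smooth_sqn n (L : R) (f : 'rV[R]_n -> R) x y : 0 <= L -> L_smooth L f ->
  sqn (grad f x - grad f y) <= L ^+ 2 * sqn (x - y).
Proof.
move=> L0 [_ /(_ x y)]; rewrite -!sqr_enorm -exprMn => h.
by rewrite lerXn2r ?nnegrE ?mulr_ge0 // sqrtr_ge0.
Qed.

Lemma derive_grad n (f : 'rV[R]_n -> R) x v : differentiable f x ->
  'D_v f x = dot (grad f x) v.
Proof.
move=> df; rewrite deriveE // [in LHS](row_sum_delta v) linear_sum /=.
by apply: eq_bigr => i _; rewrite linearZ /= mxE mulrC deriveE.
Qed.

Lemma derive_le n (f : 'rV[R]_n -> R) x v A c : derivable f x v ->
  (forall t, 0 < t -> t < 1 -> f (t *: v + x) - f x <= t * (A + c * t)) -> 'D_v f x <= A.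
Proof.
move=> df h.
have u : t^-1 *: (f (t *: v + x) - f x) @[t --> (0 : R)^'+] --> ('D_v f x : R).
  exact: (cvg_dnbhs_at_right df).
have w : A + c * t @[t --> (0 : R)^'+] --> (A : R).
  suff : A + c * t @[t --> (0 : R)^'+] --> (A + c * 0 : R) by rewrite mulr0 addr0.
  apply: cvg_at_right_filter; apply: cvgD; first exact: cvg_cst.
  by apply: cvgM; [exact: cvg_cst|exact: cvg_id].
apply: (ler_cvg_to u w).
near=> t.
  have t0 : 0 < t by near: t; exact: nbhs_right_gt.
  have t1 : t < 1 by near: t; exact: nbhs_right_lt.
  rewrite /= -[_ *: _]/(_ * _) ler_pdivrMl //; exact: h.
Unshelve. all: by end_near. Qed.

Lemma derive_ge n (f : 'rV[R]_n -> R) x v A : derivable f x v ->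
  (forall t, 0 < t -> t < 1 -> t * A <= f (t *: v + x) - f x) -> A <= 'D_v f x.
Proof.
move=> df h.
have u : t^-1 *: (f (t *: v + x) - f x) @[t --> (0 : R)^'+] --> ('D_v f x : R).
  exact: (cvg_dnbhs_at_right df).
apply: (cvgr_to_ge u).
near=> t.
have t0 : 0 < t by near: t; exact: nbhs_right_gt.
have t1 : t < 1 by near: t; exact: nbhs_right_lt.
rewrite /= -[_ *: _]/(_ * _) ler_pdivlMl //; exact: h.
Unshelve. all: by end_near. Qed.

Lemma strongly_convex_grad n (mu : R) (f : 'rV[R]_n -> R) x y :
  differentiable f x -> strongly_convex mu f ->
  f x + dot (grad f x) (y - x) + mu / 2 * sqn (y - x) <= f y.
Proof.
move=> df sc; rewrite -derive_grad // -lerBrDr -lerBrDl.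
apply: (@derive_le _ _ _ _ _ (mu / 2 * sqn (y - x))); first exact: diff_derivable.
move=> t t0 t1; have t01 : 0 <= t <= 1 by rewrite !ltW.
have := sc y x t t01; rewrite sqr_enorm => h.
have -> : t *: (y - x) + x = t *: y + (1 - t) *: x.
  by apply/rowP => i; rewrite !mxE; ring.
lra.
Qed.

Lemma convex_fun_le n (f : 'rV[R]_n -> R) x y t : convex_fun f -> 0 < t -> t < 1 ->
  f (t *: (y - x) + x) <= t * f y + (1 - t) * f x.
Proof.
move=> cf t0 t1; have t01 : 0 <= t <= 1 by rewrite !ltW.
have := cf (Itv01 (ltW t0) (ltW t1)) y x; rewrite !inE /= => /(_ I I).
have -> : t *: (y - x) + x = t *: y + (1 - t) *: x.
  by apply/rowP => i; rewrite !mxE; ring.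
by [].
Qed.

Variables (dx dy : nat) (G : 'rV[R]_dx -> 'rV[R]_dy -> R).

Lemma derivable_partial_x x y v : differentiable (uncurry_row G) (row_mx x y) ->
  derivable (G ^~ y) x v /\ 'D_v (G ^~ y) x = dot (lsubmx (grad (uncurry_row G) (row_mx x y))) v.
Proof.
(* The partial difference quotient is that of the joint function in direction (w, 0). *)
move=> dG; have e (w : 'rV[R]_dx) :
   (fun h : R => h^-1 *: (((G ^~ y) \o shift x) (h *: w) - G x y)) =
   (fun h : R => h^-1 *: ((uncurry_row G \o shift (row_mx x y)) (h *: row_mx w 0)
      - uncurry_row G (row_mx x y))).
  apply/funext => h; congr (_ *: (_ - _)); rewrite /= /uncurry_row.
    by rewrite scale_row_mx scaler0 add_row_mx add0r row_mxKl row_mxKr.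
  by rewrite row_mxKl row_mxKr.
split; first by rewrite /derivable e; exact: diff_derivable.
rewrite /derive e -[LHS]/('D_(row_mx v 0) (uncurry_row G) (row_mx x y)) derive_grad //.
rewrite /dot big_split_ord /= [X in _ + X]big1 ?addr0 => [|i _].
  by apply: eq_bigr => i _; rewrite row_mxEl !mxE.
by rewrite row_mxEr [X in _ * X]mxE mulr0.
Qed.

Lemma derivable_partial_y x y v : differentiable (uncurry_row G) (row_mx x y) ->
  derivable (G x) y v /\ 'D_v (G x) y = dot (rsubmx (grad (uncurry_row G) (row_mx x y))) v.
Proof.
move=> dG; have e (w : 'rV[R]_dy) :
   (fun h : R => h^-1 *: ((G x \o shift y) (h *: w) - G x y)) =
   (fun h : R => h^-1 *: ((uncurry_row G \o shift (row_mx x y)) (h *: row_mx 0 w)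
      - uncurry_row G (row_mx x y))).
  apply/funext => h; congr (_ *: (_ - _)); rewrite /= /uncurry_row.
    by rewrite scale_row_mx scaler0 add_row_mx add0r row_mxKl row_mxKr.
  by rewrite row_mxKl row_mxKr.
split; first by rewrite /derivable e; exact: diff_derivable.
rewrite /derive e -[LHS]/('D_(row_mx 0 v) (uncurry_row G) (row_mx x y)) derive_grad //.
rewrite /dot big_split_ord /= [X in X + _]big1 ?add0r => [|i _].
  by apply: eq_bigr => i _; rewrite row_mxEr !mxE.
by rewrite row_mxEl [X in _ * X]mxE mulr0.
Qed.

Lemma grad_uncurry x y : differentiable (uncurry_row G) (row_mx x y) ->
  grad (uncurry_row G) (row_mx x y) = row_mx (grad_x G x y) (grad_y G x y).
Proof.
move=> dG; rewrite -[LHS]hsubmxK; congr row_mx; apply/rowP => i; rewrite [RHS]mxE.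
  rewrite (derivable_partial_x (delta_mx 0 i) dG).2 /dot (bigD1 i) //= big1 => [|j ji].
    by rewrite !mxE !eqxx mulr1 addr0.
  by rewrite [delta_mx _ _ _ _]mxE eqxx (negbTE ji) mulr0.
rewrite (derivable_partial_y (delta_mx 0 i) dG).2 /dot (bigD1 i) //= big1 => [|j ji].
  by rewrite !mxE !eqxx mulr1 addr0.
by rewrite [delta_mx _ _ _ _]mxE eqxx (negbTE ji) mulr0.
Qed.

Lemma regular_instance (Lf LG Lh mux muy : R) (f : 'rV[R]_dx -> R) (h : 'rV[R]_dy -> R) :
  0 <= Lf -> 0 <= LG -> 0 <= Lh ->
  L_smooth Lf f -> strongly_convex mux f ->
  (forall y, convex_fun (fun x => G x y)) -> (forall x, convex_fun (fun y => - G x y)) ->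
  L_smooth LG (uncurry_row G) -> L_smooth Lh h -> strongly_convex muy h ->
  regular Lf LG Lh mux muy (Instance f G h (grad f) (grad h) (grad_x G) (grad_y G)).
Proof.
move=> f0 G0 h0 sf cf cx cy sG sh ch; split=> /= [x x'|x x'|y y'|y y'|x x' y|x y y'|x y x' y'].
- by apply: strongly_convex_grad => //; case: sf.
- exact: L_smooth_sqn.
- by apply: strongly_convex_grad => //; case: sh.
- exact: L_smooth_sqn.
- have dG := sG.1 (row_mx x y); have [d1 d2] := derivable_partial_x (x' - x) dG.
  have := grad_uncurry dG => /(congr1 lsubmx); rewrite row_mxKl => gE.
  rewrite -gE -d2 -lerBrDl; apply: (@derive_le _ _ _ _ _ 0) => // t t0 t1.
  by have := convex_fun_le x x' (cx y) t0 t1; lra.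
- have dG := sG.1 (row_mx x y); have [d1 d2] := derivable_partial_y (y' - y) dG.
  have := grad_uncurry dG => /(congr1 rsubmx); rewrite row_mxKr => gE.
  rewrite -gE -d2 -lerBlDl; apply: derive_ge => // t t0 t1.
  by have := convex_fun_le y y' (cy x) t0 t1; lra.
have := L_smooth_sqn (row_mx x y) (row_mx x' y') G0 sG.
rewrite !grad_uncurry; [|exact: sG.1 ..].
by rewrite !opp_row_mx !add_row_mx !sqn_row_mx.
Qed.

End Gradients.

(** * Complexity bounds *)

Section Complexity.
Variable R : realType.

(** An upper bound for the binary logarithm when x >= 1: the factor 2 is at least 1 / ln 2. *)
Definition log2_ceil (x : R) : nat := (Num.truncn (2 * ln x)).+1.

Lemma ln2_bounds : (2^-1 : R) <= ln (2 : R) <= 1.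
Proof.
apply/andP; split.
  have h : ln (2^-1 : R) <= 2^-1 - 1.
    by rewrite -[in ln _](_ : 1 + (2^-1 - 1) = 2^-1 :> R); [apply: le_ln1Dx; lra|lra].
  by rewrite lnV ?posrE // in h; lra.
by have := @le_ln1Dx R 1; rewrite (_ : 1 + 1 = 2) //; apply; lra.
Qed.

Lemma log2_ceilP (x : R) : 1 <= x -> x <= 2 ^+ log2_ceil x.
Proof.
move=> x1; have x0 : 0 < x := lt_le_trans ltr01 x1.
have l0 : 0 <= ln x by rewrite ln_ge0.
have /andP[l2 _] := ln2_bounds.
have h : 2 * ln x < (log2_ceil x)%:R.
  by have /andP[] := truncn_itv (mulr_ge0 (ler0n R 2) l0).
rewrite -ler_ln ?posrE ?exprn_gt0 // lnXn // -[_ *+ _]mulr_natr.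
have := ler_wpM2r (ler0n R (log2_ceil x)) l2.
lra.
Qed.

Lemma log2_ceil_le (x : R) : 1 <= x -> (log2_ceil x)%:R <= 2 * (1 + ln x).
Proof.
move=> x1; have l0 : 0 <= ln x by rewrite ln_ge0.
have /andP[h _] := truncn_itv (mulr_ge0 (ler0n R 2) l0).
by rewrite /log2_ceil -natr1; lra.
Qed.

Lemma iteration_number (l : nat) (lam mu : R) : 0 < mu -> mu <= lam -> lam <= 4 ^+ l * mu ->
  exists t : nat, [/\ lam <= t%:R ^+ 2 * mu, (0 < t)%N, (t.+1 <= 2 ^ (2 * l + 2))%N &
    t%:R <= 2 * Num.sqrt (lam / mu)].
Proof.
move=> mu0 ml lm.
have q1 : 1 <= lam / mu by rewrite ler_pdivlMr // mul1r.
have q4 : lam / mu <= 4 ^+ l by rewrite ler_pdivrMr.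
have s1 : 1 <= Num.sqrt (lam / mu) by rewrite -[X in X <= _]sqrtr1 ler_sqrt // (le_trans ler01).
have s2 : Num.sqrt (lam / mu) <= 2 ^+ l.
  rewrite -(ger0_norm (exprn_ge0 l (ler0n R 2))) -sqrtr_sqr ler_sqrt ?sqr_ge0 //.
  by rewrite exprAC (_ : 2 ^+ 2 = 4 :> R) //; ring.
set s := Num.sqrt _ in s1 s2 *.
have s0 : 0 <= s := le_trans ler01 s1.
(* Rounding up at most doubles, as s >= 1. *)
exists (Num.truncn s).+1; have /andP[h1 h2] := truncn_itv s0; split=> //.
- rewrite -ler_pdivrMr //; apply: (@le_trans _ _ (s ^+ 2)).
    by rewrite /s sqr_sqrtr // (le_trans ler01).
  by rewrite lerXn2r ?nnegrE // ltW.
- have : (Num.truncn s)%:R <= (2 ^ l)%:R :> R by rewrite natrX; apply: le_trans s2.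
  rewrite ler_nat addnC expnD mulnC expnM => h.
  have : (2 ^ l <= (2 ^ 2) ^ l)%N by rewrite -expnM leq_exp2l // mulSn; lia.
  have : (0 < 2 ^ l)%N by rewrite expn_gt0.
  by move: (2 ^ l)%N ((2 ^ 2) ^ l)%N h => u v; rewrite (_ : (2 ^ 2 = 4)%N) //; lia.
- by rewrite -natr1; lra.
Qed.

Lemma prod_bound (t t' : nat) (c s s' : R) :
  t%:R <= c * s -> t'%:R <= 2 * s' -> (t * t')%:R <= 2 * c * (s * s').
Proof.
move=> h h'; rewrite natrM; apply: le_trans (ler_pM _ _ h h') _ => //.
by rewrite le_eqVlt; apply/orP; left; apply/eqP; ring.
Qed.

(** Pads the nesting depth [q] to a common [p], so that both nestings share one bound. *)
Lemma cost_bound (c n p q E : nat) (K s r : R) :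
  (0 < E)%N -> (q <= p)%N -> 0 <= s -> n%:R <= r * s -> 0 <= r -> c%:R * r <= K ->
  (c * E ^ q * n)%:R <= K * E%:R ^+ p * s.
Proof.
move=> E0 qp s0 hn r0 hc; rewrite !natrM natrX.
have e : E%:R ^+ q <= E%:R ^+ p :> R by rewrite ler_weXn2l // ler1n.
apply: (@le_trans _ _ (c%:R * E%:R ^+ p * (r * s))).
  by apply: ler_pM => //; rewrite ler_wpM2l.
by rewrite mulrA ler_wpM2r // mulrAC ler_wpM2r // exprn_ge0.
Qed.

Definition calls_factor : R := 16 * 48 * 288.

Lemma calls_factor_bounds : [/\ 0 <= calls_factor, 6 * 4 <= calls_factor,
  288 * 8 <= calls_factor & (48 * 288)%N%:R * 16 <= calls_factor].
Proof. by rewrite natrM /calls_factor; split; lra. Qed.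

(** Since 2^l bounds the smoothness constants and the inverse moduli, every ratio is at most 4^l,
    and 2 l + 2 bits suffice in all loops. The square roots of the ratios then telescope. *)
Lemma solvable_saddle (dx dy l : nat) (Lf LG Lh mux muy : R) :
  0 < Lf -> 0 < LG -> 0 < Lh -> 0 < mux -> 0 < muy ->
  mux <= LG -> mux <= Lf -> muy <= LG ->
  Lf <= 2 ^+ l -> LG <= 2 ^+ l -> Lh <= 2 ^+ l -> 1 <= 2 ^+ l * mux -> 1 <= 2 ^+ l * muy ->
  let E := (600 * (2 * l + 2) ^ 2)%N in
  exists nf nh ng : nat,
    [/\ @solvable R dx dy Lf LG Lh mux muy 1 1 1 0 0 2^-1 nf nh ng,
     nf%:R <= calls_factor * E%:R ^+ 4 * Num.sqrt (LG * Lf / (mux * muy)),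
     nh%:R <= calls_factor * E%:R ^+ 4 *
       Num.max (Num.sqrt (LG * Lh / (mux * muy))) (Num.sqrt (LG ^+ 2 / (mux * muy))) &
     ng%:R <= calls_factor * E%:R ^+ 4 * Num.sqrt (LG ^+ 2 / (mux * muy))].
Proof.
move=> f0 G0 h0 x0 y0 xG xf yG bf bG bh bx bY E.
have [k0 k6 k288 k16] := calls_factor_bounds.
have E0 : (0 < E)%N by rewrite /E muln_gt0 expn_gt0 addn_gt0 orbT.
have bnd (u v : R) : 0 < v -> u <= 2 ^+ l -> 1 <= 2 ^+ l * v -> u <= 4 ^+ l * v.
  move=> v0 hu hv; apply: le_trans hu _; have p0 : 0 <= 2 ^+ l :> R by rewrite exprn_ge0.
  have -> : (4 : R) ^+ l = 2 ^+ l * 2 ^+ l by rewrite -exprMn; congr (_ ^+ _); ring.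
  by rewrite -mulrA ler_peMr.
have p0 : 0 <= 2 ^+ l :> R by rewrite exprn_ge0.
have bGl : 1 <= 2 ^+ l * LG by apply: le_trans bx _; rewrite ler_wpM2l.
have bfl : 1 <= 2 ^+ l * Lf by apply: le_trans bx _; rewrite ler_wpM2l.
have kap : LG ^+ 2 <= 4 ^+ (2 * l + 2) * mux ^+ 2.
  apply: (@le_trans _ _ ((4 ^+ l * mux) ^+ 2)).
    have h1 := bnd _ _ x0 bG bx; have h2 := le_trans (ltW G0) h1.
    by rewrite lerXn2r ?nnegrE ?(ltW G0).
  rewrite exprMn ler_wpM2r ?sqr_ge0 // -exprM ler_weXn2l ?ler1n //.
  by rewrite mulnC leq_addr.
set M := Num.max Lh LG.
have MG : LG <= M by rewrite le_max lexx orbT.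
have bM : M <= 2 ^+ l by rewrite ge_max bh bG.
have [t1 [a1 b1 c1 d1]] := iteration_number y0 yG (bnd _ _ y0 bG bY).
have [th [ah bh' ch dh]] := iteration_number G0 MG (bnd _ _ G0 bM bGl).
pose XG := Num.sqrt (LG ^+ 2 / (mux * muy)).
pose XM := Num.sqrt (LG * M / (mux * muy)).
have hM : XM <= Num.max (Num.sqrt (LG * Lh / (mux * muy))) XG.
  rewrite le_max /XM /XG /M expr2; case: (leP Lh LG) => _; by rewrite lexx ?orbT.
have d0 (u v : R) : 0 < v -> 0 < u -> 0 <= u / v by move=> ? ?; rewrite divr_ge0 // ltW.
have sq (u v w z : R) : 0 < v -> 0 < u -> 0 < w -> 0 < z ->
   Num.sqrt (u / v) * Num.sqrt (w / z) = Num.sqrt (u * w / (v * z)).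
  by move=> ? ? ? ?; rewrite -sqrtrM ?d0 // invfM mulrACA.
have M0 : 0 < M := lt_le_trans G0 MG.
have nz (u : R) : 0 < u -> u != 0 by move=> ?; rewrite gt_eqF.
have [hL|/ltW hL] := leP LG Lf.
  have [t2 [a2 b2 c2 d2]] := iteration_number x0 xG (bnd _ _ x0 bG bx).
  have [tf [af bf' cf df]] := iteration_number G0 hL (bnd _ _ G0 bf bGl).
  have sol := solvable_saddle_sharp_f dx dy f0 G0 h0 x0 y0 hL kap
    a1 b1 c1 a2 b2 c2 af bf' cf ah bh' ch.
  do 3 eexists; split; first exact: sol; rewrite -/E.
  - apply: (cost_bound (r := 8) E0 _ (sqrtr_ge0 _)) => //.
    have := prod_bound (prod_bound d1 d2) df; rewrite !sq ?mulr_gt0 //.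
    have -> : LG * LG * Lf / (muy * mux * LG) = LG * Lf / (mux * muy).
      by field; rewrite !nz.
    by congr (_ <= _ * _); ring.
  - apply: le_trans (ler_wpM2l _ hM); last by rewrite mulr_ge0 // exprn_ge0.
    apply: (cost_bound (r := 8) E0 _ (sqrtr_ge0 _)) => //.
    have := prod_bound (prod_bound d1 d2) dh; rewrite !sq ?mulr_gt0 //.
    have -> : LG * LG * M / (muy * mux * LG) = LG * M / (mux * muy).
      by field; rewrite !nz.
    by congr (_ <= _ * _); ring.
  - apply: (cost_bound (r := 4) E0 _ (sqrtr_ge0 _)) => //.
    have := prod_bound d1 d2; rewrite !sq ?mulr_gt0 //.
    have -> : LG * LG / (muy * mux) = LG ^+ 2 / (mux * muy).
      by field; rewrite !nz.
    by congr (_ <= _ * _); ring.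
have [t2 [a2 b2 c2 d2]] := iteration_number x0 xf (bnd _ _ x0 bf bx).
have [t3 [a3 b3 c3 d3]] := iteration_number f0 hL (bnd _ _ f0 bG bfl).
have sol := solvable_saddle_flat_f dx dy f0 G0 h0 x0 y0 hL kap
  a1 b1 c1 a2 b2 c2 a3 b3 c3 ah bh' ch.
do 3 eexists; split; first exact: sol; rewrite -/E.
- apply: (cost_bound (r := 4) E0 _ (sqrtr_ge0 _)) => //.
  have := prod_bound d1 d2; rewrite !sq ?mulr_gt0 //.
  have -> : LG * Lf / (muy * mux) = LG * Lf / (mux * muy) by rewrite [muy * _]mulrC.
  by congr (_ <= _ * _); ring.
- apply: le_trans (ler_wpM2l _ hM); last by rewrite mulr_ge0 // exprn_ge0.
  apply: (cost_bound (r := 16) E0 _ (sqrtr_ge0 _)) => //.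
  have := prod_bound (prod_bound (prod_bound d1 d2) d3) dh; rewrite !sq ?mulr_gt0 //.
  have -> : LG * Lf * LG * M / (muy * mux * Lf * LG) = LG * M / (mux * muy).
    by field; rewrite !nz.
  by congr (_ <= _ * _); ring.
- apply: (cost_bound (r := 8) E0 _ (sqrtr_ge0 _)) => //.
  have := prod_bound (prod_bound d1 d2) d3; rewrite !sq ?mulr_gt0 //.
  have -> : LG * Lf * LG / (muy * mux * Lf) = LG ^+ 2 / (mux * muy).
    by field; rewrite !nz.
  by congr (_ <= _ * _); ring.
Qed.

End Complexity.

(** * Primal gap and distance to the saddle point *)

Section SaddleGap.
Variables (R : realType) (dx dy : nat) (Lf LG Lh mux muy : R).
Variable I : instance R dx dy.
Hypotheses (Lf_gt0 : 0 < Lf) (mux_gt0 : 0 < mux) (muy_gt0 : 0 < muy).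
Hypothesis rI : regular Lf LG Lh mux muy I.

Let le11 : 0 <= (1 : R) <= 1. Proof. by rewrite lexx ler01. Qed.

(* The constant of [op_lipschitz] without regularization. *)
Definition op_lip : R := 3 * (Lf ^+ 2 + Lh ^+ 2 + LG ^+ 2 + 0 ^+ 2 + 0 ^+ 2).
Definition gap_factor : R := op_lip * (1 + LG ^+ 2 * mux^-1 ^+ 2) + 1.

Lemma op_lip_gt0 : 0 < op_lip.
Proof.
by rewrite mulr_gt0 // -!addrA ltr_pwDl ?exprn_gt0 // !addr_ge0 ?sqr_ge0.
Qed.

Lemma best_response y : exists x, opX 1 1 0 I x y = 0.
Proof.
apply: (strongly_monotone_root mux_gt0 op_lip_gt0) => x x'.
  have := op_monotone 0 0 le11 le11 le11 x y x' y rI.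
  by rewrite subrr sqn0 dot0r mulr0 !addr0 mul1r.
have := op_lipschitz 0 0 le11 le11 le11 x y x' y rI.
rewrite subrr sqn0 addr0; apply: le_trans.
by rewrite lerDl sqn_ge0.
Qed.

Lemma valueE x y : value 1 1 1 0 0 0 0 I x y = vf I x + vG I x y - vh I y.
Proof. by rewrite /value !dot0l; ring. Qed.

Lemma best_response_min x y x' : opX 1 1 0 I x y = 0 ->
  vf I x + vG I x y <= vf I x' + vG I x' y.
Proof.
move=> e; have := value_convex 1 0 0 le11 le11 0 0 x x' y rI.
rewrite e subrr dot0l !valueE => h.
have := mulr_ge0 (ltW mux_gt0) (sqn_ge0 (x' - x)); lra.
Qed.

Lemma best_response_max x y y' : opY 1 1 0 I x y = 0 ->
  vG I x y' - vh I y' <= vG I x y - vh I y.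
Proof.
move=> e; have := value_concave 1 0 0 le11 le11 0 0 x y y' rI.
rewrite e subrr dot0l !valueE => h.
have := mulr_ge0 (ltW muy_gt0) (sqn_ge0 (y' - y)); lra.
Qed.

Variables (xs : 'rV[R]_dx) (ys : 'rV[R]_dy).
Hypotheses (rootX : opX 1 1 0 I xs ys = 0) (rootY : opY 1 1 0 I xs ys = 0).

Lemma root_saddle_point : saddle_point (vf I) (vG I) (vh I) xs ys.
Proof.
move=> x y; apply/andP.
have := best_response_max y rootY; have := best_response_min x rootX.
by split; lra.
Qed.

(** Strong monotonicity bounds the unknown distance by the gradient, which the algorithm can
    query. *)
Lemma root_dist x y : sqn (x - xs) + sqn (y - ys) <=
  (mux^-1 + muy^-1) ^+ 2 * (sqn (opX 1 1 0 I x y) + sqn (opY 1 1 0 I x y)).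
Proof.
have := op_monotone 0 0 le11 le11 le11 x y xs ys rI.
rewrite rootX rootY !subr0 !mul1r !addr0; set nu := mux^-1 + muy^-1.
have nux : 1 <= nu * mux.
  have -> : nu * mux = 1 + muy^-1 * mux by rewrite /nu; field; rewrite !gt_eqF.
  by rewrite lerDl mulr_ge0 ?invr_ge0 // ltW.
have nuy : 1 <= nu * muy.
  have -> : nu * muy = 1 + mux^-1 * muy by rewrite /nu; field; rewrite !gt_eqF.
  by rewrite lerDl mulr_ge0 ?invr_ge0 // ltW.
have nu0 : 0 <= nu by rewrite addr_ge0 // invr_ge0 ltW.
move: (opX _ _ _ _ _ _) (opY _ _ _ _ _ _) (x - xs) (y - ys) => u v c d h.
have h1 := ler_wpM2l nu0 h.
have h2 := ler_wpM2r (sqn_ge0 c) nux; have h3 := ler_wpM2r (sqn_ge0 d) nuy.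
have h4 := sqn_ge0 (nu *: u - c); have h5 := sqn_ge0 (nu *: v - d).
move: h1 h2 h3 h4 h5; dot_expand => *; lra.
Qed.

Lemma root_grad x y : sqn (opX 1 1 0 I x y) + sqn (opY 1 1 0 I x y) <=
  op_lip * (sqn (x - xs) + sqn (y - ys)).
Proof.
have := op_lipschitz 0 0 le11 le11 le11 x y xs ys rI.
by rewrite rootX rootY !subr0.
Qed.

(** With xh the best response to y, concavity bounds the gap by the product of [opY] at (xh, y) with
    y - ys. This operator value is Lipschitz in the distance, since xh is by [sensitivityX]; so the
    gap is quadratic in |y - ys|. *)
Lemma root_eps_solution eps y : gap_factor * sqn (y - ys) <= eps ->
  eps_solution (vf I) (vG I) (vh I) eps y.
Proof.
move=> hy; have /choice [xhat hx] := best_response.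
exists (- vG I (xhat y) y - vf I (xhat y)).
exists (fun y => vh I y - vG I (xhat y) y - vf I (xhat y)).
exists (vh I ys - vG I (xhat ys) ys - vf I (xhat ys)).
split.
- split; first by exists (xhat y).
  by move=> x; have := best_response_min x (hx y); lra.
- move=> y'; split; first by exists (xhat y').
  by move=> x; have := best_response_min x (hx y'); lra.
- split; first by exists ys.
  move=> y'; have := best_response_max y' rootY.
  have := best_response_min (xhat ys) rootX; have := best_response_min xs (hx y'); lra.
set xh := xhat y.
have sens : sqn (xh - xs) <= LG ^+ 2 * mux^-1 ^+ 2 * sqn (y - ys).
  have m1 : 0 < 1 * mux + 0 by rewrite mul1r addr0.
  have := sensitivityX 0 le11 le11 le11 rI m1 (hx y) rootX.
  rewrite mul1r addr0 -/xh -[in X in _ -> X](ler_pM2l (exprn_gt0 2 mux_gt0)).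
  by congr (_ <= _); field; rewrite gt_eqF.
have grd : sqn (opY 1 1 0 I xh y) <= op_lip * (1 + LG ^+ 2 * mux^-1 ^+ 2) * sqn (y - ys).
  have := root_grad xh y; have := sqn_ge0 (opX 1 1 0 I xh y).
  have := ler_wpM2l (ltW op_lip_gt0) sens; lra.
have := value_concave 1 0 0 le11 le11 0 0 xh y ys rI; rewrite !valueE subr0.
have := mulr_ge0 (ltW muy_gt0) (sqn_ge0 (ys - y)).
have := sqn_ge0 (opY 1 1 0 I xh y - (y - ys)).
have := sqn_ge0 (opY 1 1 0 I xh y).
have := best_response_min xh (hx ys).
have dt : dot (opY 1 1 0 I xh y) (ys - y) = - dot (opY 1 1 0 I xh y) (y - ys).
  by rewrite -dotNr opprB.
rewrite dt; have := sqn_ge0 (y - ys).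
move: hy grd; rewrite /gap_factor.
move: (opY 1 1 0 I xh y) (y - ys) => u v.
dot_expand => *; lra.
Qed.

End SaddleGap.

Lemma run_computes (X Y Z : Type) (of_ : X -> X) (oh : Y -> Y) (ox : X -> Y -> X)
    (oy : X -> Y -> Y) (s : routine X Y Z) (Q : Z -> Prop) (g : Z -> Y) nf nh ng :
  computes of_ oh ox oy s Q nf nh ng ->
  let o := run_oracles of_ oh ox oy (s (fun z => Output X (g z))) in
  exists z, [/\ Q z, out o = g z &
    [/\ (calls_f o <= nf)%N, (calls_h o <= nh)%N, (calls_Gx o <= ng)%N & (calls_Gy o <= ng)%N]].
Proof.
move=> [z [a [b [c [d [Qz ha hb]]]]]]; rewrite geq_max => /andP[hc hd] e o.
by exists z; rewrite /o e /= !addn0.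
Qed.

(** * Polylogarithmic factors *)

Section FinalBounds.
Variable R : realType.

(** The exponent 9 is 1 from the number [J] of halvings plus 8 from E^4, where [E] is quadratic in
    the logarithm. The leading 1 counts the initial gradient query. *)
Lemma soft_O_bound (C J n E : nat) (K c S eps X : R) :
  0 <= K -> 0 <= c -> 0 <= S -> 0 < eps -> 1 <= X ->
  J%:R <= 24 * (1 + ln (1 + S)) * (1 + ln (1 + eps^-1)) ->
  E%:R <= c * (1 + ln (1 + S)) ^+ 2 -> n%:R <= K * E%:R ^+ 4 * X ->
  1 + 24 * K * c ^+ 4 <= C%:R ->
  (1 + J * n)%:R <= soft_O C 9 S eps X.
Proof.
move=> K0 c0 S0 e0 X1 hJ hE hn hC; rewrite /soft_O.
have a1 : 1 <= 1 + ln (1 + S) by rewrite lerDl ln_ge0 // lerDl.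
have b1 : 1 <= 1 + ln (1 + eps^-1) by rewrite lerDl ln_ge0 // lerDl invr_ge0 ltW.
move: (1 + ln (1 + S)) (1 + ln (1 + eps^-1)) a1 b1 hJ hE => a b a1 b1 hJ hE.
have a0 : 0 <= a := le_trans ler01 a1; have b0 : 0 <= b := le_trans ler01 b1.
have X0 : 0 <= X := le_trans ler01 X1.
have hn2 : n%:R <= K * (c * a ^+ 2) ^+ 4 * X.
  apply: le_trans hn _; rewrite ler_wpM2r // ler_wpM2l // lerXn2r ?nnegrE //.
  by rewrite mulr_ge0 // sqr_ge0.
have hJn : J%:R * n%:R <= 24 * a * b * (K * (c * a ^+ 2) ^+ 4 * X) by apply: ler_pM.
have hb : b <= b ^+ 9 by rewrite -[X in X <= _]expr1 ler_weXn2l.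
have ab1 : 1 <= a ^+ 9 * b ^+ 9 by rewrite -exprMn exprn_ege1 // mulr_ege1.
have hX : 1 <= a ^+ 9 * b ^+ 9 * X by rewrite mulr_ege1.
have K4 : 0 <= 24 * K * c ^+ 4 * a ^+ 9 * X.
  by rewrite !mulr_ge0 // exprn_ge0.
apply: (@le_trans _ _ ((1 + 24 * K * c ^+ 4) * (a ^+ 9 * b ^+ 9 * X))).
  rewrite natrD natrM; have := ler_wpM2l K4 hb.
  have e : 24 * a * b * (K * (c * a ^+ 2) ^+ 4 * X) = 24 * K * c ^+ 4 * a ^+ 9 * X * b by ring.
  rewrite e in hJn => h.
  have -> : (1 + 24 * K * c ^+ 4) * (a ^+ 9 * b ^+ 9 * X) =
    a ^+ 9 * b ^+ 9 * X + 24 * K * c ^+ 4 * a ^+ 9 * X * b ^+ 9 by ring.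
  by rewrite lerD //; apply: le_trans h.
have -> : C%:R * a ^+ 9 * b ^+ 9 * X = C%:R * (a ^+ 9 * b ^+ 9 * X) by ring.
by rewrite ler_wpM2r // (le_trans ler01).
Qed.

Lemma iteration_bound (s eps x : R) : 1 <= s -> 0 < eps -> 0 <= x ->
  x <= 171 * s ^+ 12 ->
  (log2_ceil (1 + x / eps))%:R <= 24 * (1 + ln s) * (1 + ln (1 + eps^-1)).
Proof.
move=> s1 e0 x0 hx; have s0 : 0 < s := lt_le_trans ltr01 s1.
have q0 : 0 <= x / eps by rewrite divr_ge0 // ltW.
have i0 : 0 < eps^-1 by rewrite invr_gt0.
apply: le_trans (log2_ceil_le _) _; first by rewrite lerDl.
have a0 : 0 <= ln s by rewrite ln_ge0.
have b0 : 0 <= ln (1 + eps^-1) by rewrite ln_ge0 // lerDl ltW.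
have s12 : 1 <= s ^+ 12 by rewrite exprn_ege1.
have h : 1 + x / eps <= 2 ^+ 8 * s ^+ 12 * (1 + eps^-1).
  have -> : (2 : R) ^+ 8 = 256 by ring.
  have := ler_wpM2r (ltW i0) hx; have := ler_wpM2r (ltW i0) s12.
  by lra.
have := ln2_bounds R => /andP[_ l2].
have : ln (1 + x / eps) <= 8 * ln 2 + 12 * ln s + ln (1 + eps^-1).
  have p1 : 0 < 1 + eps^-1 by rewrite addr_gt0.
  have -> : 8 * ln 2 + 12 * ln s + ln (1 + eps^-1) = ln (2 ^+ 8 * s ^+ 12 * (1 + eps^-1)).
    have [q8 q12] : 0 < (2 : R) ^+ 8 /\ 0 < s ^+ 12 by rewrite !exprn_gt0.
    rewrite (lnM (_ : _ * _ \is Num.pos)) ?posrE ?mulr_gt0 // lnM ?posrE //.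
    by rewrite (lnXn 8) // (lnXn 12) // -[ln 2 *+ 8]mulr_natl -[ln s *+ 12]mulr_natl.
  by rewrite ler_ln ?posrE ?mulr_gt0 ?exprn_gt0 // ltr_pwDl.
have := mulr_ge0 a0 b0.
lra.
Qed.

End FinalBounds.

(** * The full algorithm *)

Section MainAlgorithm.
Variables (R : realType) (dx dy : nat).
Notation X := 'rV[R]_dx.
Notation Y := 'rV[R]_dy.
Variables (Lf LG Lh mux muy : R).
Hypotheses (Lf_gt0 : 0 < Lf) (mux_gt0 : 0 < mux) (muy_gt0 : 0 < muy).
Notation regular := (@regular R dx dy Lf LG Lh mux muy).
Notation gap := (gap_factor Lf LG Lh mux).

(* The gradient at the starting point bounds the distance to the saddle       *)
(* point, so it tells how many times this distance has to be halved.          *)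
Definition dist_bound (g1 : X) (g2 : Y) : R := (mux^-1 + muy^-1) ^+ 2 * (sqn g1 + sqn g2).

Definition saddle_routine (s : X -> Y -> X -> Y -> routine X Y (X * Y)) (eps : R) x0 y0 :
    routine X Y (X * Y) :=
  bind (fun k => Query_f x0 k) (fun gf =>
  bind (fun k => Query_h y0 k) (fun gh =>
  bind (fun k => Query_Gx x0 y0 (fun u => Query_Gy x0 y0 (fun v => k (u, v)))) (fun g =>
  iterate (log2_ceil (1 + gap * dist_bound (gf + g.1) (gh - g.2) / eps))
    (fun o => s 0 0 o.1 o.2) (x0, y0)))).

Lemma gap_factor_gt0 : 0 < gap.
Proof.
rewrite addr_gt0 // mulr_gt0 ?op_lip_gt0 // ltr_pwDl // mulr_ge0 ?sqr_ge0 //.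
Qed.

(** The routine is fixed before the instance, while [J] is computed from its answers at run time;
    only the bound on [J] involves the distance to the saddle point. *)
Lemma saddle_routineP (eps : R) (x0 : X) (y0 : Y) nf nh ng : 0 < eps ->
  solvable dx dy Lf LG Lh mux muy 1 1 1 0 0 2^-1 nf nh ng ->
  exists s : routine X Y (X * Y), forall I, regular I ->
  forall xs ys, opX 1 1 0 I xs ys = 0 -> opY 1 1 0 I xs ys = 0 ->
  exists J : nat,
    (forall S : R, Lf + LG + Lh + mux^-1 + muy^-1 <= S -> 0 <= LG -> 0 <= Lh ->
       sqn (x0 - xs) + sqn (y0 - ys) <= S ^+ 2 ->
       J%:R <= 24 * (1 + ln (1 + S)) * (1 + ln (1 + eps^-1))) /\
    computes (gf I) (gh I) (gx I) (gy I) s (fun o => gap * sqn (o.2 - ys) <= eps)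
      (1 + J * nf) (1 + J * nh) (1 + J * ng).
Proof.
move=> e0 [s hs]; exists (saddle_routine s eps x0 y0) => I rI xs ys rX rY.
have g0 := gap_factor_gt0.
pose B := dist_bound (opX 1 1 0 I x0 y0) (opY 1 1 0 I x0 y0).
have rd := root_dist mux_gt0 muy_gt0 rI rX rY x0 y0; rewrite -/(dist_bound _ _) -/B in rd.
have B0 : 0 <= B by apply: le_trans rd; rewrite addr_ge0 ?sqn_ge0.
have gB : 0 <= gap * B by rewrite mulr_ge0 // ltW.
exists (log2_ceil (1 + gap * B / eps)); split.
  move=> S hS G0 h0 hD.
  have [ix iy] : 0 < mux^-1 /\ 0 < muy^-1 by rewrite !invr_gt0.
  have f0 := Lf_gt0.
  have S0 : 0 <= S by lra.
  apply: iteration_bound => //; first by rewrite lerDl.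
  set z := 1 + S; have z1 : 1 <= z by rewrite lerDl.
  have z0 : 0 <= z := le_trans ler01 z1.
  have sqz (u : R) : 0 <= u -> u <= S -> u ^+ 2 <= z ^+ 2.
    by move=> u0 uS; rewrite lerXn2r ?nnegrE // /z; lra.
  have b1 : op_lip Lf LG Lh <= 9 * z ^+ 2.
    have h1 : Lf ^+ 2 <= z ^+ 2 by apply: sqz; lra.
    have h2 : Lh ^+ 2 <= z ^+ 2 by apply: sqz; lra.
    have h3 : LG ^+ 2 <= z ^+ 2 by apply: sqz; lra.
    by rewrite /op_lip expr0n /=; lra.
  have l0 : 0 <= op_lip Lf LG Lh by rewrite ltW // op_lip_gt0.
  have z2 : 1 <= z ^+ 2 by rewrite exprn_ege1.
  have b2 : gap <= 19 * z ^+ 6.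
    have h3 : LG ^+ 2 * mux^-1 ^+ 2 <= z ^+ 2 * z ^+ 2.
      by apply: ler_pM; rewrite ?sqr_ge0 //; apply: sqz; lra.
    have h4 : op_lip Lf LG Lh * (1 + LG ^+ 2 * mux^-1 ^+ 2) <= 9 * z ^+ 2 * (1 + z ^+ 2 * z ^+ 2).
      apply: ler_pM => //; last by rewrite lerD2l.
      by rewrite addr_ge0 // mulr_ge0 ?sqr_ge0.
    have h5 : z ^+ 2 <= z ^+ 6 by rewrite ler_weXn2l.
    have h6 : 1 <= z ^+ 6 by rewrite exprn_ege1.
    have e6 : z ^+ 2 * (z ^+ 2 * z ^+ 2) = z ^+ 6 by ring.
    by rewrite /gap_factor; lra.
  have b3 : B <= z ^+ 2 * (9 * z ^+ 2 * z ^+ 2).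
    rewrite /B /dist_bound; apply: ler_pM; rewrite ?sqr_ge0 ?addr_ge0 ?sqn_ge0 //.
      by apply: sqz; lra.
    apply: le_trans (root_grad rI rX rY x0 y0) _.
    apply: ler_pM => //; first by rewrite addr_ge0 ?sqn_ge0.
    by apply: le_trans hD _; apply: sqz.
  (* The constants of [iteration_bound]: [gap] is at most 19 z^6 and [B] at most 9 z^6. *)
  have -> : 171 * z ^+ 12 = 19 * z ^+ 6 * (z ^+ 2 * (9 * z ^+ 2 * z ^+ 2)) by ring.
  by apply: ler_pM => //; rewrite ltW.
set J := log2_ceil _.
rewrite -[(1 + J * nf)%N]/(1 + (0 + (0 + J * nf)))%N.
rewrite -[(1 + J * nh)%N]/(0 + (1 + (0 + J * nh)))%N.
rewrite -[(1 + J * ng)%N]/(0 + (0 + (1 + J * ng)))%N.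
apply: computes_bind (computes_f _ _ _ _ x0) _ => _ ->.
apply: computes_bind (computes_h _ _ _ _ y0) _ => _ ->.
apply: computes_bind (computes_G _ _ _ _ x0 y0) _ => _ ->; cbn [fst snd].
have -> : dist_bound (gf I x0 + gx I x0 y0) (gh I y0 - gy I x0 y0) = B.
  by rewrite /B /opX /opY !scale1r !scale0r !addr0.
rewrite -/J.
apply: computes_weaken (computes_iterate (I := fun i o =>
  sqn (o.1 - xs) + sqn (o.2 - ys) <= 2^-1 ^+ i * (sqn (x0 - xs) + sqn (y0 - ys))) _ _ _) => //.
- move=> o /= ho; have n1 := sqn_ge0 (o.1 - xs).
  have h1 : sqn (o.2 - ys) <= 2^-1 ^+ J * B.
    apply: (@le_trans _ _ (sqn (o.1 - xs) + sqn (o.2 - ys))); first by rewrite lerDr.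
    by apply: le_trans ho _; rewrite ler_wpM2l // exprn_ge0 // invr_ge0.
  apply: le_trans (ler_wpM2l (ltW g0) h1) _.
  have p2 : 0 < 2 ^+ J :> R by rewrite exprn_gt0.
  rewrite exprVn mulrCA mulrC ler_pdivrMr // (mulrC eps) -ler_pdivrMr //.
  apply: le_trans (log2_ceilP _); last by rewrite lerDl divr_ge0 // ltW.
  by rewrite lerDr.
- move=> i [x y] /= h; apply: computes_weaken (hs I rI 0 0 x y xs ys rX rY) => // o.
  by move=> /le_trans; apply; rewrite exprS -mulrA ler_wpM2l // invr_ge0.
- by rewrite expr0 mul1r.
Qed.

End MainAlgorithm.

Lemma nat_upper_bound (R : realType) (x : R) : exists C : nat, x <= C%:R.
Proof.
exists (Num.truncn `|x|).+1; apply: le_trans (ler_norm x) _.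
by have /andP[_ /ltW] := truncn_itv (normr_ge0 x).
Qed.

Lemma inner_calls_bound (R : realType) (l : nat) (a : R) : 1 <= a -> l%:R <= 2 * a ->
  (600 * (2 * l + 2) ^ 2)%:R <= 600 * 36 * a ^+ 2.
Proof.
move=> a1 la; have h6 : (2 * l + 2)%:R <= 6 * a by rewrite natrD natrM; lra.
have : (2 * l + 2)%:R ^+ 2 <= (6 * a) ^+ 2.
  by rewrite lerXn2r ?nnegrE // (le_trans _ h6).
rewrite natrM natrX; move: (_%:R ^+ 2) => u; lra.
Qed.

Theorem corollary4 (R : realType) :
  exists C k : nat,
  forall (dx dy : nat) (L_f L_G L_h mu_x mu_y : R),
    0 < L_f -> 0 < L_G -> 0 < L_h -> 0 < mu_x -> 0 < mu_y ->
    mu_x <= L_G -> mu_x <= L_f -> mu_y <= L_G ->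
  forall (eps : R), 0 < eps ->
  forall (x0 : 'rV[R]_dx) (y0 : 'rV[R]_dy),
  exists A : algorithm 'rV[R]_dx 'rV[R]_dy,
  forall (f : 'rV[R]_dx -> R) (G : 'rV[R]_dx -> 'rV[R]_dy -> R)
         (h : 'rV[R]_dy -> R),
    L_smooth L_f f -> strongly_convex mu_x f ->
    (forall y, convex_fun (fun x => G x y)) ->
    (forall x, convex_fun (fun y => - G x y)) ->
    L_smooth L_G (uncurry_row G) ->
    L_smooth L_h h -> strongly_convex mu_y h ->
  eps_solution f G h eps (out (run f G h A)) /\
  exists (xs : 'rV[R]_dx) (ys : 'rV[R]_dy),
    saddle_point f G h xs ys /\
    let D := enorm (row_mx (x0 - xs) (y0 - ys)) in
    let S := data_size L_f L_G L_h mu_x mu_y D in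
    [/\ (calls_f (run f G h A))%:R <=
          soft_O C k S eps (Num.sqrt (L_G * L_f / (mu_x * mu_y))),
        (calls_h (run f G h A))%:R <=
          soft_O C k S eps
            (Num.max (Num.sqrt (L_G * L_h / (mu_x * mu_y)))
                     (Num.sqrt (L_G ^+ 2 / (mu_x * mu_y)))),
        (calls_Gx (run f G h A))%:R <=
          soft_O C k S eps (Num.sqrt (L_G ^+ 2 / (mu_x * mu_y))) &
        (calls_Gy (run f G h A))%:R <=
          soft_O C k S eps (Num.sqrt (L_G ^+ 2 / (mu_x * mu_y)))].
Proof.
pose c : R := 600 * 36.
have c0 : 0 <= c by rewrite /c; lra.
have K0 : 0 <= calls_factor R by rewrite /calls_factor; lra.
have [C hC] := nat_upper_bound (1 + 24 * calls_factor R * c ^+ 4).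
exists C, 9%N => dx dy Lf LG Lh mux muy f0 G0 h0 mx0 my0 xG xf yG eps e0 x0 y0.
(* The algorithm may depend on the parameters but not on [D], so [l] is computed from [S0], the part
   of [S] that is known in advance. *)
pose S0 := Lf + LG + Lh + mux^-1 + muy^-1.
have [ix iy] : 0 < mux^-1 /\ 0 < muy^-1 by rewrite !invr_gt0.
have S00 : 0 <= S0 by rewrite /S0 !addr_ge0 // ltW.
pose l := log2_ceil (1 + S0).
have hl : 1 + S0 <= 2 ^+ l by apply: log2_ceilP; rewrite lerDl.
have [nf [nh [ng [sol bf bh bg]]]] : exists nf nh ng : nat,
    [/\ solvable dx dy Lf LG Lh mux muy 1 1 1 0 0 2^-1 nf nh ng,
     nf%:R <= calls_factor R * (600 * (2 * l + 2) ^ 2)%:R ^+ 4 * Num.sqrt (LG * Lf / (mux * muy)),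
     nh%:R <= calls_factor R * (600 * (2 * l + 2) ^ 2)%:R ^+ 4 *
       Num.max (Num.sqrt (LG * Lh / (mux * muy))) (Num.sqrt (LG ^+ 2 / (mux * muy))) &
     ng%:R <= calls_factor R * (600 * (2 * l + 2) ^ 2)%:R ^+ 4 * Num.sqrt (LG ^+ 2 / (mux * muy))].
  by apply: solvable_saddle => //; rewrite -?ler_pdivrMr // ?mul1r;
    apply: le_trans hl; rewrite /S0; lra.
have [s hs] := saddle_routineP f0 mx0 my0 x0 y0 e0 sol.
exists (s (fun o => Output _ o.2)) => f G h sf cf cx cy sG sh ch.
pose I := Instance f G h (grad f) (grad h) (grad_x G) (grad_y G).
have rI : regular Lf LG Lh mux muy I by apply: regular_instance => //; exact: ltW.
have le11 : 0 <= (1 : R) <= 1 by rewrite lexx ler01.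
have [||xs [ys [rX rY]]] := op_root f0 le11 le11 le11 0 0 rI (a := 0) (b := 0);
  rewrite ?mul1r ?addr0 //.
have [J [hJ cmp]] := hs I rI xs ys rX rY.
have [w [hw ew [qf qh qx qy]]] := run_computes (fun o => o.2) cmp.
split; first by rewrite /run ew; exact: (root_eps_solution f0 mx0 my0 rI rX rY).
exists xs, ys; split; first exact: (root_saddle_point mx0 my0 rI rX rY).
move=> D S.
have D0 : 0 <= D by exact: sqrtr_ge0.
have S0S : S0 <= S by rewrite /S /data_size -/S0 lerDl.
have SS : 0 <= S := le_trans S00 S0S.
have {}hJ : J%:R <= 24 * (1 + ln (1 + S)) * (1 + ln (1 + eps^-1)).
  apply: hJ => //; [exact: ltW|exact: ltW|rewrite -sqn_row_mx -sqr_enorm -/D].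
  by rewrite lerXn2r ?nnegrE // /S /data_size -/S0 lerDr.
have hE : (600 * (2 * l + 2) ^ 2)%:R <= c * (1 + ln (1 + S)) ^+ 2.
  apply: inner_calls_bound; first by rewrite lerDl ln_ge0 // lerDl.
  apply: le_trans (log2_ceil_le _) _; first by rewrite lerDl.
  by rewrite ler_pM2l // lerD2l ler_ln ?posrE ?ltr_pwDl // lerD2l.
have mm : 0 < mux * muy by rewrite mulr_gt0.
have sqrt_ge1 (u v : R) : 0 < v -> v <= u -> 1 <= Num.sqrt (u / v).
  move=> v0 vu; have q1 : 1 <= u / v by rewrite ler_pdivlMr // mul1r.
  by rewrite -[X in X <= _]sqrtr1 ler_sqrt // (le_trans ler01).
have X1 : 1 <= Num.sqrt (LG * Lf / (mux * muy)).
  by apply: sqrt_ge1 => //; rewrite mulrC; apply: ler_pM => //; exact: ltW.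
have X2 : 1 <= Num.sqrt (LG ^+ 2 / (mux * muy)).
  by apply: sqrt_ge1 => //; rewrite expr2; apply: ler_pM => //; exact: ltW.
have X3 : 1 <= Num.max (Num.sqrt (LG * Lh / (mux * muy))) (Num.sqrt (LG ^+ 2 / (mux * muy))).
  by rewrite le_max X2 orbT.
have calls_le q n (X : R) : 1 <= X -> (q <= 1 + J * n)%N ->
    n%:R <= calls_factor R * (600 * (2 * l + 2) ^ 2)%:R ^+ 4 * X ->
    q%:R <= soft_O C 9 S eps X.
  move=> X1' qn hn; apply: le_trans (_ : (1 + J * n)%:R <= _); first by rewrite ler_nat.
  exact: (soft_O_bound K0 c0 SS e0 X1' hJ hE hn hC).
by split; [apply: calls_le X1 qf bf|apply: calls_le X3 qh bh|apply: calls_le X2 qx bg|apply: calls_le X2 qy bg].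
Qed.
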